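(* Let $Q(\underline{x}) = x_1^2 + x_1x_2 + x_2^2 - 3x_3^2$ and $F=\{\underline{x}\in\mathbb{Z}^3 : x_2>x_1>0,\ x_3>0\}$. Then: (1) The five matrices $$N_1=\begin{bmatrix}1&0&0\\3&7&12\\2&4&7\end{bmatrix},\quad N_2=\begin{bmatrix}0&1&0\\7&3&12\\4&2&7\end{bmatrix},\quad N_3=\begin{bmatrix}1&1&0\\-4&3&12\\-2&2&7\end{bmatrix},\quad N_4=\begin{bmatrix}1&1&0\\3&-4&12\\2&-2&7\end{bmatrix},\quad N_5=\begin{bmatrix}0&1&0\\-7&-4&12\\-4&-2&7\end{bmatrix}$$ together with the base triples $(2,11,7)^T$ and $(1,22,13)^T$ form a matrix generating system for the primitive solutions of $Q(\underline x)=0$ in $F$. (2) Up to homeomorphic conjugacy, with conjugacy map $\pi(x,y)=\frac{y-x}{x+1}$, the 1-dimensional dynamical system corresponding to this generating system is the map on $(0,\sqrt3)$ (defined off finitely many points) $$T_5(t)=\begin{cases}\frac{t}{1-t}& t\in\left(0,\frac{\sqrt3}{1+\sqrt3}\right),\\ \frac{3-3t}{t}& t\in\left(\frac{\sqrt3}{1+\sqrt3},1\right),\\ \frac{3-3t}{2t-3}& t\in\left(1,\frac{3+\sqrt3}{2+\sqrt3}\right),\\ \frac{3-2t}{t-1}& t\in\left(\frac{3+\sqrt3}{2+\sqrt3},\frac32\right),\\ \frac{2t-3}{2-t}& t\in\left(\frac32,\sqrt3\right).\end{cases}$$ (3) The measure $d\mu=\frac1t\,dt$ on $(0,\sqrt3)$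 is $\sigma$-finite, $T_5$-invariant, ergodic and conservative.
   Context: A solution $(a,b,c)^T\in\mathbb{Z}^3$ of $Q=0$ is primitive if $a,b,c$ have no common divisor greater than $1$. Matrix generating system: matrices $N_1,\dots,N_k$ and a finite set of base triples form a matrix generating system for the primitive solutions in $F$ if the vectors $N_{a_1}N_{a_2}\cdots N_{a_n}\underline{b}$ ($n\ge 0$, $a_j\in\{1,\dots,k\}$, $\underline b$ a base triple) are exactly the primitive solutions of $Q=0$ in $F$, and every primitive solution in $F$ has exactly one representation of this form (unique $n$, $a_1,\dots,a_n$ and $\underline b$). Corresponding 1-dimensional system: let $\mathcal{E}=\{(x,y)\in\mathbb{R}^2: Q(x,y,1)=0\}$ and let $FA\subset\mathcal{E}$ be the arc of points $(x,y)$ with $y>x>0$. A matrix $A$ preserving $Q$ acts on points $(x,y)$ of $\mathcal{E}$ by $\widehat{A}(x,y)=(v_1/v_3,v_2/v_3)$ where $(v_1,v_2,v_3)^T=A(x,y,1)^T$. Put $\mathcal{D}_i=FA\cap\widehat{N_i}(FA)$; these sets are pairwise disjoint and cover $FA$ up to finitely many points. The system is the map $\widehat{T}$ on $FA$ (defined off finitely many points) given by $\widehat T=\widehat{N_i^{-1}}$ on $\mathcal{D}_i$. That $T_5$ is this system under the conjugacy map $\pi$ means that $\pi: FA\to(0,\sqrt3)$ is a homeomorphism and $T_5=\pi\circ\widehat T\circ\pi^{-1}$ off finitely many points. A measure $\mu$ is $T$-invariant if $\mu(T^{-1}A)=\mu(A)$ for all Borel $A$; ergodic if $T^{-1}A=A$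 implies $\mu(A)=0$ or $\mu(A^c)=0$; conservative if there is no set $W$ of positive measure with $W,T^{-1}W,T^{-2}W,\dots$ pairwise disjoint. Statements about $T$ are understood off the Lebesgue-null set of points where some iterate is undefined. *)

(* Defs.v *)
From HB Require Import structures.
From mathcomp Require Import all_boot all_order all_algebra.
From mathcomp Require Import all_classical all_reals all_analysis measurable_realfun.
Set Implicit Arguments.
Unset Strict Implicit.
Unset Printing Implicit Defensive.
Import Order.TTheory GRing.Theory Num.Theory.
Import numFieldNormedType.Exports.
Local Open Scope classical_set_scope.
Local Open Scope ring_scope.

Definition col3 {R : pzRingType} (a b c : R) : 'cV[R]_3 :=
  \col_(i < 3) [:: a; b; c]`_i.

Definition mx3 {R : pzRingType} (rows : seq (seq R)) : 'M[R]_3 :=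
  \matrix_(i < 3, j < 3) (nth [::] rows i)`_j.

(* Coordinates are 0-based: [x 0 0], [x 1 0], [x 2 0] are x_1, x_2, x_3. *)
Definition Qform {R : comPzRingType} (x : 'cV[R]_3) : R :=
  x 0 0 ^+ 2 + x 0 0 * x 1 0 + x 1 0 ^+ 2 - 3 * x 2 0 ^+ 2.

Definition primitive (x : 'cV[int]_3) : Prop :=
  forall d : int, 1 < d -> ~ (forall i, (d %| x i 0%R)%Z).

Definition word_value {k : nat} (M : 'I_k -> 'M[int]_3) (w : seq 'I_k)
    (b : 'cV[int]_3) : 'cV[int]_3 :=
  (\prod_(a <- w) M a) *m b.

Definition matrix_generating_system {k : nat} (M : 'I_k -> 'M[int]_3)
    (base : seq 'cV[int]_3) (q : 'cV[int]_3 -> int) (F : set 'cV[int]_3) :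
    Prop :=
  (forall x : 'cV[int]_3,
     [/\ q x = 0, primitive x & F x] <->
     exists w b, b \in base /\ x = word_value M w b) /\
  (forall w w' b b', b \in base -> b' \in base ->
     word_value M w b = word_value M w' b' -> w = w' /\ b = b').

Definition cone : set 'cV[int]_3 :=
  [set x | x 1 0 > x 0 0 /\ x 0 0 > 0 /\ x 2 0 > 0].

Definition Nmx : 'I_5 -> 'M[int]_3 := tnth [tuple
  mx3 [:: [:: 1; 0; 0];  [:: 3; 7; 12];   [:: 2; 4; 7]];
  mx3 [:: [:: 0; 1; 0];  [:: 7; 3; 12];   [:: 4; 2; 7]];
  mx3 [:: [:: 1; 1; 0];  [:: -4; 3; 12];  [:: -2; 2; 7]];
  mx3 [:: [:: 1; 1; 0];  [:: 3; -4; 12];  [:: 2; -2; 7]];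
  mx3 [:: [:: 0; 1; 0];  [:: -7; -4; 12]; [:: -4; -2; 7]]].

Definition base_triples : seq 'cV[int]_3 := [:: col3 2 11 7; col3 1 22 13].

Section one_dimensional_system.
Context {R : realType}.

Definition FA : set (R * R) :=
  [set p | Qform (col3 p.1 p.2 1) = 0 /\ p.2 > p.1 /\ p.1 > 0].

Definition preserves_Q (A : 'M[R]_3) : Prop :=
  forall x : 'cV[R]_3, Qform (A *m x) = Qform x.

Definition hat (A : 'M[R]_3) (p : R * R) : R * R :=
  let v := A *m col3 p.1 p.2 1 in (v 0 0 / v 2 0, v 1 0 / v 2 0).

Context {k : nat} (M : 'I_k -> 'M[int]_3).

Definition real_mx (i : 'I_k) : 'M[R]_3 := map_mx intr (M i).

Definition branch_arc (i : 'I_k) : set (R * R) := FA `&` hat (real_mx i) @` FA.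

(* [hat] is an action on the conic, and [hatT] below is unambiguous and defined
   off finitely many points of [FA]. *)
Definition well_defined_system : Prop :=
  [/\ forall i, real_mx i \in unitmx,
      forall i, preserves_Q (real_mx i),
      trivIset setT branch_arc &
      finite_set (FA `\` \bigcup_i branch_arc i)].

(* Its value outside [\bigcup_i branch_arc i] is meaningless. *)
Definition hatT (p : R * R) : R * R :=
  if [pick i | `[< branch_arc i p >]] is Some i then hat (invmx (real_mx i)) p
  else p.

End one_dimensional_system.

Definition homeomorphism_between {T U : topologicalType} (A : set T) (B : set U)
    (f : T -> U) (g : U -> T) : Prop :=
  [/\ set_fun A B f /\ set_fun B A g,
      {in A, cancel f g}, {in B, cancel g f},
      {within A, continuous f} & {within B, continuous g}].

(* [S] is a map on [A] with domain of definition [domS], and [T] is a map on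
   [B] with domain of definition [domT]; [T = f \o S \o f^-1] off a finite
   set. *)
Definition conjugate_off_finite {X Y : topologicalType}
    (A domS : set X) (S : X -> X) (B domT : set Y) (T : Y -> Y) (f : X -> Y) :
    Prop :=
  exists2 g : Y -> X, homeomorphism_between A B f g &
    exists2 E : set Y, finite_set E &
      forall t, B t -> ~ E t ->
        [/\ domT t, domS (g t), A (S (g t)) & T t = f (S (g t))].

Section T5.
Context {R : realType}.

Definition sqrt3 : R := Num.sqrt 3.

Definition J : set R := `]0, sqrt3[.

Definition cut1 : R := sqrt3 / (1 + sqrt3).
Definition cut3 : R := (3 + sqrt3) / (2 + sqrt3).

Definition conj_map (p : R * R) : R := (p.2 - p.1) / (p.1 + 1).

Definition T5_dom : set R :=
  `]0, cut1[ `|` `]cut1, 1[ `|` `]1, cut3[ `|` `]cut3, 3 / 2[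
  `|` `]3 / 2, sqrt3[.

(* Its value outside [T5_dom] is meaningless. *)
Definition T5 (t : R) : R :=
  if t \in `]0, cut1[ then t / (1 - t)
  else if t \in `]cut1, 1[ then (3 - 3 * t) / t
  else if t \in `]1, cut3[ then (3 - 3 * t) / (2 * t - 3)
  else if t \in `]cut3, 3 / 2[ then (3 - 2 * t) / (t - 1)
  else if t \in `]3 / 2, sqrt3[ then (2 * t - 3) / (2 - t)
  else 0.

End T5.

(* The points at which all iterates of [T], with domain of definition [D], are
   defined; [T] maps this set to itself, and the notions below concern this
   restriction of [T]. *)
Definition iterable {X : Type} (D : set X) (T : X -> X) : set X :=
  [set t | forall n, D (iter n T t)].

Section ergodic_theory.
Context {d : measure_display} {X : measurableType d} {R : realType}.
Variables (mu : {measure set X -> \bar R}) (D : set X) (T : X -> X).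

Definition preim (n : nat) (A : set X) : set X :=
  iterable D T `&` (iter n T) @^-1` A.

Definition invariant_measure : Prop :=
  forall A, measurable A -> A `<=` iterable D T -> mu (preim 1 A) = mu A.

Definition ergodic : Prop :=
  forall A, measurable A -> A `<=` iterable D T -> preim 1 A = A ->
    mu A = 0%E \/ mu (iterable D T `\` A) = 0%E.

Definition conservative : Prop :=
  ~ exists W, [/\ measurable W, W `<=` iterable D T, (0 < mu W)%E &
                  trivIset setT (fun n => preim n W)].

End ergodic_theory.

Section inverse_density.
Context {R : realType}.

Definition inv_density_measure (A : set (measurableTypeR R)) : \bar R :=
  (\int[@lebesgue_measure R]_(t in J `&` A) (t^-1)%:E)%E.

Let inv_density0 : inv_density_measure set0 = 0%E.
Proof. by rewrite /inv_density_measure setI0 integral_set0. Qed.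

Let inv_density_ge0 A : (0 <= inv_density_measure A)%E.
Proof.
apply: integral_ge0 => t [+ _]; rewrite /J /= in_itv /= => /andP[t0 _].
by rewrite lee_fin invr_ge0 ltW.
Qed.

Let measurable_inv_density :
  measurable_fun (@J R) (EFin \o (@GRing.inv R)).
Proof.
apply/measurable_EFinP; apply: open_continuous_measurable_fun.
  exact: interval_open.
move=> t; rewrite inE /J /= in_itv /= => /andP[t0 _].
by apply: inv_continuous; rewrite gt_eqF.
Qed.

Let inv_density_sigma_additive : semi_sigma_additive inv_density_measure.
Proof.
move=> F mF tF mUF.
have mJ : measurable (J : set (measurableTypeR R)) by exact: measurable_itv.
rewrite /inv_density_measure setI_bigcupr.
have t0 (t : R) : J t -> (0 <= (t^-1)%:E)%E.
  rewrite /J /= in_itv /= => /andP[? _].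
  by rewrite lee_fin invr_ge0 ltW.
rewrite ge0_integral_bigcup.
- apply: is_cvg_nneseries => n _ _.
  by apply: integral_ge0 => t [/t0].
- by move=> n; exact: measurableI.
- rewrite -setI_bigcupr; apply: measurable_funS measurable_inv_density => //.
- by move=> t [n _ [/t0]].
- by apply: trivIset_setIl.
Qed.

HB.instance Definition _ := isMeasure.Build _ _ _ inv_density_measure
  inv_density0 inv_density_ge0 inv_density_sigma_additive.

End inverse_density.

(* Main.v *)
(* The conic is parametrised by the slope t of its chords through (-1, -1),
   which is [conj_map]. In this coordinate N_i becomes the inverse branch
   [branch_inv (5 - i)] of T5, a Moebius map of J = (0, sqrt 3) onto an interval
   between consecutive points 0 < cut1 < 1 < cut3 < 3/2 < sqrt 3. A primitive solution
   has rational slope; at the cuts 1 and 3/2 it is a base triple, cut1 and cut3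
   are irrational, and in every other case exactly one N_i^-1 keeps it in the
   cone, decreasing its third coordinate.

   Invariance of dt/t amounts to the identity sum_i |S_i'| / S_i = 1/s for the
   inverse branches S_i, integrated over the rays ]a, oo[. Ergodicity and
   conservativity both follow from one fact: if B and C have positive measure,
   some orbit starting in B meets C. Every orbit enters ]cut1, sqrt 3[
   infinitely often, where the inverse branches of the iterates have bounded
   distortion and contract by powers of 1/3; at a density point of B they
   squeeze an amount of C proportional to their scale next to that point. *)
Require Import Defs.
From HB Require Import structures.
From mathcomp Require Import all_boot all_order all_algebra.
From mathcomp Require Import all_classical all_reals all_analysis measurable_realfun.
From mathcomp Require Import ring lra zify.
Set Implicit Arguments.
Unset Strict Implicit.
Unset Printing Implicit Defensive.
Import Order.TTheory GRing.Theory Num.Theory.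
Import numFieldNormedType.Exports.
Local Open Scope classical_set_scope.
Local Open Scope ring_scope.

Ltac nonzero := do ?(apply/andP; split); 
  first [by rewrite gt_eqF//; lra | by rewrite lt_eqF//; lra].

(** * The inverse branches of T5 *)

Section inverse_branches.
Context {R : realType}.
Implicit Types (s t : R) (i : 'I_5).
Local Notation w := (@sqrt3 R).

Lemma sqrt3_gt0 : 0 < w. Proof. by rewrite sqrtr_gt0. Qed.

Lemma sqrt3_sqr : w ^+ 2 = 3. Proof. by rewrite sqr_sqrtr. Qed.

Lemma sqrt3_bounds : 17 / 10 < w < 18 / 10.
Proof. by have := sqrt3_gt0; have := sqrt3_sqr; nra. Qed.

(** Branches are numbered from 0 by the position of their image in J from left to right. The even
    ones increase, the odd ones decrease. *)
Definition branch_inv (i : nat) (s : R) : R :=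
  match i with
  | 0%N => s / (1 + s)
  | 1%N => 3 / (s + 3)
  | 2%N => (3 + 3 * s) / (2 * s + 3)
  | 3%N => (s + 3) / (s + 2)
  | _ => (2 * s + 3) / (s + 2)
  end.

Definition branch_cut (i : nat) : R :=
  match i with
  | 0%N => 0
  | 1%N => cut1
  | 2%N => 1
  | 3%N => cut3
  | 4%N => 3 / 2
  | _ => w
  end.

(** Case analysis with literal ordinals, so that [branch_inv] and [branch_cut] reduce by computation
    in each case. *)
Lemma I5_ind (P : 'I_5 -> Prop) :
  P (@Ordinal 5 0 isT) -> P (@Ordinal 5 1 isT) -> P (@Ordinal 5 2 isT) ->
  P (@Ordinal 5 3 isT) -> P (@Ordinal 5 4 isT) -> forall i, P i.
Proof.
move=> p0 p1 p2 p3 p4 [[|[|[|[|[|//]]]]] lt5].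
- by rewrite (bool_irrelevance lt5 isT).
- by rewrite (bool_irrelevance lt5 isT).
- by rewrite (bool_irrelevance lt5 isT).
- by rewrite (bool_irrelevance lt5 isT).
- by rewrite (bool_irrelevance lt5 isT).
Qed.

Lemma J_itv s : J s <-> 0 < s /\ s < w.
Proof. by rewrite /J /= in_itv /=; split=> /andP. Qed.

Lemma branch_cut_lt i : branch_cut i < branch_cut i.+1.
Proof.
have := sqrt3_gt0; have := sqrt3_sqr; have := sqrt3_bounds => /andP[? ?] ? ?.
elim/I5_ind: i; rewrite /= /cut1 /cut3.
- by rewrite divr_gt0// addr_gt0.
- by rewrite ltr_pdivrMr ?addr_gt0//; lra.
- by rewrite ltr_pdivlMr ?addr_gt0//; lra.
- by rewrite ltr_pdivrMr ?addr_gt0//; lra.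
- by lra.
Qed.

Lemma branch_cut_mono (i j : nat) : (i <= j <= 5)%N ->
  branch_cut i <= branch_cut j.
Proof.
move=> /andP[ij j5]; elim: j ij j5 => [|j IH]; first by case: i.
rewrite leq_eqVlt => /predU1P[-> //|ij j5].
apply: (le_trans (IH ij (ltnW j5))).
exact: ltW (branch_cut_lt (Ordinal j5)).
Qed.

(** The cuts are the images of 0 and sqrt 3; after clearing denominators and using w^2 = 3, each
    inequality reduces to 0 < s or s < w. *)
Lemma branch_inv_itv i s : J s ->
  branch_cut i < branch_inv i s < branch_cut i.+1.
Proof.
move=> /J_itv[s0 sw].
have := sqrt3_gt0; have := sqrt3_sqr; have := sqrt3_bounds => /andP[? ?] ? ?.
elim/I5_ind: i; rewrite /= /cut1 /cut3; apply/andP; split.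
- by rewrite divr_gt0// addr_gt0.
- rewrite ltr_pdivrMr ?addr_gt0// mulrAC ltr_pdivlMr ?addr_gt0//; nra.
- rewrite ltr_pdivrMr ?addr_gt0// mulrAC ltr_pdivlMr ?addr_gt0//; nra.
- rewrite ltr_pdivrMr ?addr_gt0//; lra.
- rewrite ltr_pdivlMr ?addr_gt0//; lra.
- rewrite ltr_pdivrMr ?addr_gt0// 1?mulrAC ?ltr_pdivlMr ?addr_gt0//; nra.
- rewrite ltr_pdivrMr ?addr_gt0// mulrAC ltr_pdivlMr ?addr_gt0//; nra.
- rewrite ltr_pdivrMr ?addr_gt0//; lra.
- rewrite ltr_pdivlMr ?addr_gt0//; lra.
- rewrite ltr_pdivrMr ?addr_gt0//; nra.
Qed.

Lemma branch_inv_J i s : J s -> J (branch_inv i s).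
Proof.
move=> Js; have /andP[lo hi] := branch_inv_itv i Js; apply/J_itv; split.
  by rewrite (le_lt_trans _ lo)// (@branch_cut_mono 0)//= ltnW.
by rewrite (lt_le_trans hi)// (@branch_cut_mono _ 5)// ltn_ord/=.
Qed.

Lemma T5_domP t : T5_dom t <->
  exists i : 'I_5, branch_cut i < t < branch_cut i.+1.
Proof.
rewrite /T5_dom /= !in_itv /=; split.
  move=> [[[[|]|]|]|] ?; [exists 0|exists 1|exists 2%:R|exists 3%:R|exists 4%:R];
    by [].
move=> [i]; elim/I5_ind: i => /=; tauto.
Qed.

Lemma T5_branch_inv i s : J s -> T5 (branch_inv i s) = s.
Proof.
move=> Js; have := branch_inv_itv i Js; move/J_itv: Js => [s0 sw].
(* The order of the cuts refutes the tests of [T5] for the intervals further left. *)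
have := @branch_cut_mono 1 2 isT; have := @branch_cut_mono 2 3 isT.
have := @branch_cut_mono 3 4 isT; have := @branch_cut_mono 1 3 isT.
have := @branch_cut_mono 1 4 isT; have := @branch_cut_mono 2 4 isT.
rewrite /T5 !in_itv.
elim/I5_ind: i => /= c24 c14 c13 c34 c23 c12 /andP[lo hi].
- rewrite lo hi /=; field; nonzero.
- rewrite lo hi (ltNge _ cut1) (ltW lo) andbF/=; field; nonzero.
- rewrite lo hi !(ltNge _ cut1, ltNge _ 1) ?(ltW lo) ?(le_trans _ (ltW lo))//.
  rewrite !andbF/=; field; nonzero.
- rewrite lo hi !(ltNge _ cut1, ltNge _ 1, ltNge _ cut3) ?(ltW lo)//.
  rewrite ?(le_trans _ (ltW lo))// !andbF/=; field; nonzero.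
- rewrite lo hi !(ltNge _ cut1, ltNge _ 1, ltNge _ cut3, ltNge _ (3/2)).
  rewrite ?(ltW lo) ?(le_trans _ (ltW lo))// !andbF/=; field; nonzero.
Qed.

(** The witnesses are the five formulas of [T5], the third rewritten with a positive denominator. *)
Lemma branch_inv_surj i t : branch_cut i < t < branch_cut i.+1 ->
  exists2 s, J s & t = branch_inv i s.
Proof.
have := sqrt3_gt0; have := sqrt3_sqr; have := sqrt3_bounds => /andP[? ?] ? w0.
elim/I5_ind: i => /= /andP[lo hi].
- have t1 : 0 < 1 - t by rewrite subr_gt0 (lt_trans hi)// (branch_cut_lt (@Ordinal 5 1 isT)).
  exists (t / (1 - t)); last by field; nonzero.
  apply/J_itv; rewrite divr_gt0// ltr_pdivrMr//; split => //.
  by move: hi; rewrite ltr_pdivlMr ?addr_gt0//; lra.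
- have t1 : 0 < t by rewrite (lt_trans _ lo)// divr_gt0 ?addr_gt0.
  exists ((3 - 3 * t) / t); last by field; nonzero.
  apply/J_itv; rewrite divr_gt0 ?ltr_pdivrMr//; last by lra.
  by move: lo; rewrite ltr_pdivrMr ?addr_gt0//; split => //; nra.
- have := branch_cut_lt (@Ordinal 5 3 isT) => /= ?.
  have t1 : 0 < 3 - 2 * t by lra.
  exists ((3 * t - 3) / (3 - 2 * t)); last by field; nonzero.
  apply/J_itv; rewrite divr_gt0 ?ltr_pdivrMr//; last by lra.
  by move: hi; rewrite ltr_pdivlMr ?addr_gt0//; split => //; nra.
- have := branch_cut_lt (@Ordinal 5 2 isT) => /= ?.
  have t1 : 0 < t - 1 by lra.
  exists ((3 - 2 * t) / (t - 1)); last by field; nonzero.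
  apply/J_itv; rewrite divr_gt0 ?ltr_pdivrMr//; last by lra.
  by move: lo; rewrite ltr_pdivrMr ?addr_gt0//; split => //; nra.
- have t1 : 0 < 2 - t by lra.
  exists ((2 * t - 3) / (2 - t)); last by field; nonzero.
  by apply/J_itv; rewrite divr_gt0 ?ltr_pdivrMr//; [split => //; nra|lra].
Qed.

End inverse_branches.

(** * The conic and its parametrisation *)

Section conic.
Context {R : realType}.
Implicit Types (s t : R) (p : R * R) (i : 'I_5).

Lemma col3_eta (T : pzRingType) (v : 'cV[T]_3) :
  v = col3 (v 0 0) (v 1 0) (v 2 0).
Proof.
by apply/matrixP => i j; rewrite !mxE (ord1 j); case: i => [[|[|[|//]]]] ?;
  rewrite /=; congr (v _ _); apply: val_inj.
Qed.

Lemma mulmx_col3 (T : pzRingType) (A : 'M[T]_3) (a b c : T) :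
  A *m col3 a b c = col3 (A 0 0 * a + A 0 1 * b + A 0 2 * c)
    (A 1 0 * a + A 1 1 * b + A 1 2 * c) (A 2 0 * a + A 2 1 * b + A 2 2 * c).
Proof.
rewrite [LHS]col3_eta !mxE !big_ord_recl !big_ord0 !mxE /= !addr0 !addrA.
have l1 : lift ord0 ord0 = 1 :> 'I_3 by exact: val_inj.
have l2 : lift ord0 (lift ord0 ord0) = 2 :> 'I_3 by exact: val_inj.
by rewrite l2 l1.
Qed.

Lemma col3E (T : pzRingType) (a b c : T) :
  (col3 a b c 0 0 = a) * (col3 a b c 1 0 = b) * (col3 a b c 2 0 = c).
Proof. by rewrite !mxE. Qed.

Definition branch_image i (a b c : R) : 'cV[R]_3 :=
  match val i with
  | 0%N => col3 a (3 * a + 7 * b + 12 * c) (2 * a + 4 * b + 7 * c)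
  | 1%N => col3 b (7 * a + 3 * b + 12 * c) (4 * a + 2 * b + 7 * c)
  | 2%N => col3 (a + b) (- 4 * a + 3 * b + 12 * c) (- 2 * a + 2 * b + 7 * c)
  | 3%N => col3 (a + b) (3 * a - 4 * b + 12 * c) (2 * a - 2 * b + 7 * c)
  | _ => col3 b (- 7 * a - 4 * b + 12 * c) (- 4 * a - 2 * b + 7 * c)
  end.

Lemma real_mx_col3 i a b c :
  real_mx Nmx i *m col3 a b c = branch_image i a b c.
Proof.
rewrite mulmx_col3 /real_mx /branch_image /Nmx (tnth_nth 0).
elim/I5_ind: i => /=; rewrite !mxE /= ?rmorphN /= ?rmorph_nat; congr col3; ring.
Qed.

(** The second intersection of the conic with the line y = (1 + t) x + t through (-1, -1). *)
Definition param t : R * R :=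
  ((3 - t ^+ 2) / (t ^+ 2 + 3 * t + 3),
   (2 * t ^+ 2 + 6 * t + 3) / (t ^+ 2 + 3 * t + 3)).

Lemma J_sqr t : J t <-> 0 < t /\ t ^+ 2 < 3.
Proof.
rewrite J_itv -sqrt3_sqr; split => -[t0 tw]; split => //.
  by rewrite ltr_pXn2r// nnegrE ltW// sqrt3_gt0.
by rewrite -(@ltr_pXn2r _ 2)// nnegrE ltW// sqrt3_gt0.
Qed.

Lemma FA_param t : J t -> FA (param t).
Proof.
move=> /J_sqr[t0 t3]; have q0 : 0 < t ^+ 2 + 3 * t + 3 by nra.
rewrite /FA /= /Qform !col3E; split; first by field; nonzero.
by rewrite divr_gt0 ?ltr_pM2r ?invr_gt0 ?subr_gt0//; split => //; nra.
Qed.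

Lemma conj_mapK_param t : J t -> conj_map (param t) = t.
Proof.
by move=> /J_sqr[t0 t3]; have t20 := sqr_ge0 t; rewrite /conj_map /=; field; nonzero.
Qed.

Lemma conj_map_J p : FA p -> J (conj_map p).
Proof.
case: p => x y; rewrite /FA /= /Qform !col3E => -[xy [yx x0]]; apply/J_sqr.
rewrite /conj_map /= divr_gt0 ?subr_gt0//; last by lra.
split=> //; rewrite expr_div_n ltr_pdivrMr ?exprn_gt0//; last by lra.
by nra.
Qed.

Lemma param_conj_map p : FA p -> param (conj_map p) = p.
Proof.
move=> pFA; have := conj_map_J pFA => /J_sqr; move: pFA.
case: p => x y; rewrite /FA /= /Qform !col3E => -[xy [yx x0]].
rewrite /conj_map /=; set t := (y - x) / (x + 1) => -[t0 t3].
have x1 : x + 1 != 0 by nonzero.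
have yE : y = (1 + t) * x + t by rewrite /t; field.
have q0 : t ^+ 2 + 3 * t + 3 != 0 by rewrite gt_eqF//; nra.
(* On the line, the equation of the conic is (x + 1) ((t^2 + 3 t + 3) x - (3 - t^2)) = 0; the factor
   x + 1 cancels. *)
have xq : x * (t ^+ 2 + 3 * t + 3) = 3 - t ^+ 2.
  apply/eqP; rewrite -subr_eq0 -(mulrI_eq0 _ (mulfI x1)); apply/eqP.
  by rewrite -[RHS]xy yE; ring.
have yq : y * (t ^+ 2 + 3 * t + 3) = 2 * t ^+ 2 + 6 * t + 3.
  by rewrite yE mulrDl -mulrA xq; ring.
by rewrite /param -xq -yq !mulfK.
Qed.

(** The matrices run through the intervals from right to left, hence [rev_ord]. The bound on the
    third coordinate keeps the denominator of [hat] nonzero and later yields the strict growth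
    behind the descent. *)
Lemma hat_param i s : J s ->
  1 < (real_mx Nmx i *m col3 (param s).1 (param s).2 1) 2 0 /\
  hat (real_mx Nmx i) (param s) = param (branch_inv (rev_ord i) s).
Proof.
move=> /J_sqr[s0 s3]; have s20 := sqr_ge0 s.
have q0 : 0 < s ^+ 2 + 3 * s + 3 by lra.
rewrite /hat real_mx_col3 /branch_image /param.
elim/I5_ind: i => /=; rewrite !col3E; split.
(* The excess of the third coordinate over 1, times s^2 + 3 s + 3, is in each case a polynomial
   positive on J. *)
- rewrite -subr_gt0 -(pmulr_lgt0 _ q0).
  rewrite [ltRHS](_ : _ = 12 * s ^+ 2 + 42 * s + 36); first lra.
  by field; nonzero.
- by rewrite /branch_inv /=; congr (_, _); field; nonzero.
- rewrite -subr_gt0 -(pmulr_lgt0 _ q0).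
  rewrite [ltRHS](_ : _ = 6 * s ^+ 2 + 30 * s + 36); first lra.
  by field; nonzero.
- by rewrite /branch_inv /=; congr (_, _); field; nonzero.
- rewrite -subr_gt0 -(pmulr_lgt0 _ q0).
  rewrite [ltRHS](_ : _ = 12 * s ^+ 2 + 30 * s + 18); first lra.
  by field; nonzero.
- by rewrite /branch_inv /=; congr (_, _); field; nonzero.
- rewrite -subr_gt0 -(pmulr_lgt0 _ q0).
  rewrite [ltRHS](_ : _ = 6 * s + 18); first lra.
  by field; nonzero.
- by rewrite /branch_inv /=; congr (_, _); field; nonzero.
- rewrite -subr_gt0 -(pmulr_lgt0 _ q0).
  rewrite [ltRHS](_ : _ = 6 * s ^+ 2 + 6 * s); first by nra.
  by field; nonzero.
- by rewrite /branch_inv /=; congr (_, _); field; nonzero.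
Qed.

End conic.

(** * The system on the conic arc and its conjugacy with T5 *)

Section one_dimensional_system_of_N.
Context {R : realType}.
Implicit Types (s t : R) (p : R * R) (i j : 'I_5).

Definition inner_cuts : set R := [set cut1; 1; cut3; 3 / 2].

Lemma T5_dom_J t : T5_dom t -> J t.
Proof.
by move=> /T5_domP[i /(branch_inv_surj (R:=R))[s Js ->]]; exact: branch_inv_J.
Qed.

Lemma J_T5_dom t : J t -> ~ inner_cuts t -> T5_dom t.
Proof.
move=> /J_itv[t0 tw] tcut; rewrite /T5_dom /= !in_itv /= t0 tw andbT /=.
have [t1|t1|tE] := ltgtP t cut1; [by do 4 left| |by case: tcut; left; left; left].
have [t2|t2|tE] := ltgtP t 1;
  [by do 3 left; right| |by case: tcut; left; left; right].
have [t3|t3|tE] := ltgtP t cut3;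
  [by do 2 left; right| |by case: tcut; left; right].
have [t4|t4|tE] := ltgtP t (3 / 2);
  [by left; right|by right|by case: tcut; right].
Qed.

Lemma T5_dom_inner_cuts t : T5_dom t -> ~ inner_cuts t.
Proof.
move=> /T5_domP[i]; elim/I5_ind: i => /= /andP[lo hi] [[[]|]|] E;
  have := @branch_cut_mono R 1 2 isT; have := @branch_cut_mono R 2 3 isT;
  have := @branch_cut_mono R 3 4 isT; move: lo hi; rewrite /= E; lra.
Qed.

Lemma branch_inv_inj i j s s' : J s -> J s' ->
  branch_inv i s = branch_inv j s' -> i = j /\ s = s'.
Proof.
move=> Js Js' E; split; last by rewrite -(T5_branch_inv i Js) E T5_branch_inv.
have := branch_inv_itv i Js; have := branch_inv_itv j Js'.
rewrite E => /andP[lo hi] /andP[lo' hi'].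
have [ij|ji|/val_inj//] := ltngtP i j.
- have := @branch_cut_mono R i.+1 j; rewrite ij ltnW// => /(_ isT).
  by move=> /(lt_le_trans hi')/(lt_trans lo); rewrite ltxx.
- have := @branch_cut_mono R j.+1 i; rewrite ji ltnW// => /(_ isT).
  by move=> /(lt_le_trans hi)/(lt_trans lo'); rewrite ltxx.
Qed.

Lemma param_inj s t : J s -> J t -> param s = param t -> s = t.
Proof. by move=> Js Jt E; rewrite -(conj_mapK_param Js) E conj_mapK_param. Qed.

Lemma branch_arcP i p : branch_arc Nmx i p <->
  exists2 s, J s & p = param (branch_inv (rev_ord i) s).
Proof.
split=> [[pFA [q qFA <-]]|[s Js ->]].
  exists (conj_map q); first exact: conj_map_J.
  by have [_ <-] := hat_param i (conj_map_J qFA); rewrite param_conj_map.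
split; first by apply: FA_param; exact: branch_inv_J.
by exists (param s); [exact: FA_param|have [] := hat_param i Js].
Qed.

(** Integral inverses: they make the matrices invertible over the integers, and by [map_mx] over the
    reals. *)
Definition Nmx_inv : 'I_5 -> 'M[int]_3 := tnth [tuple
  mx3 [:: [:: 1; 0; 0];   [:: 3; 7; -12];  [:: -2; -4; 7]];
  mx3 [:: [:: 3; 7; -12]; [:: 1; 0; 0];    [:: -2; -4; 7]];
  mx3 [:: [:: -3; -7; 12]; [:: 4; 7; -12]; [:: -2; -4; 7]];
  mx3 [:: [:: 4; 7; -12]; [:: -3; -7; 12]; [:: -2; -4; 7]];
  mx3 [:: [:: -4; -7; 12]; [:: 1; 0; 0];   [:: -2; -4; 7]]].

Lemma mx3_mul (T : pzRingType) (a b c d e f g h k a' b' c' d' e' f' g' h' k' : T) :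
  mx3 [:: [:: a; b; c]; [:: d; e; f]; [:: g; h; k]] *m
  mx3 [:: [:: a'; b'; c']; [:: d'; e'; f']; [:: g'; h'; k']] =
  mx3 [::
    [:: a * a' + b * d' + c * g'; a * b' + b * e' + c * h'; a * c' + b * f' + c * k'];
    [:: d * a' + e * d' + f * g'; d * b' + e * e' + f * h'; d * c' + e * f' + f * k'];
    [:: g * a' + h * d' + k * g'; g * b' + h * e' + k * h'; g * c' + h * f' + k * k']].
Proof.
apply/matrixP => i j; rewrite !mxE !big_ord_recl big_ord0 !mxE addr0 addrA.
by case: i => [[|[|[|//]]] ?]; case: j => [[|[|[|//]]] ?].
Qed.

Lemma mx3_1 (T : pzRingType) :
  1%:M = mx3 [:: [:: 1; 0; 0]; [:: 0; 1; 0]; [:: 0; 0; 1]] :> 'M[T]_3.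
Proof.
apply/matrixP => i j; rewrite !mxE.
by case: i => [[|[|[|//]]] ?]; case: j => [[|[|[|//]]] ?].
Qed.

Lemma Nmx_mul_inv i : Nmx i *m Nmx_inv i = 1%:M.
Proof.
rewrite mx3_1 /Nmx /Nmx_inv !(tnth_nth 0).
by elim/I5_ind: i; rewrite /= mx3_mul.
Qed.

Lemma Nmx_unit i : Nmx i \in unitmx.
Proof. by have [] := mulmx1_unit (Nmx_mul_inv i). Qed.

Lemma real_mx_unit i : @real_mx R 5 Nmx i \in unitmx.
Proof.
suff /mulmx1_unit[] : real_mx Nmx i *m map_mx intr (Nmx_inv i) = 1%:M :> 'M[R]_3 by [].
by rewrite -map_mxM Nmx_mul_inv map_mx1.
Qed.

Lemma real_mx_preserves_Q i : preserves_Q (@real_mx R 5 Nmx i).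
Proof.
move=> x; rewrite [x]col3_eta real_mx_col3 /Qform /branch_image.
by elim/I5_ind: i => /=; rewrite !col3E; ring.
Qed.

Lemma FA_branch_arc p : FA p -> ~ inner_cuts (conj_map p) ->
  exists i, branch_arc Nmx i p.
Proof.
move=> pFA /(J_T5_dom (conj_map_J pFA))/T5_domP[i /(branch_inv_surj (R:=R))[s Js E]].
by exists (rev_ord i); apply/branch_arcP; exists s; rewrite // rev_ordK -E param_conj_map.
Qed.

Lemma branch_arc_inj i j p : branch_arc Nmx i p -> branch_arc Nmx j p -> i = j.
Proof.
move=> /branch_arcP[s Js ->] /branch_arcP[s' Js'] /param_inj E.
have [||/rev_ord_inj//] := branch_inv_inj Js Js' (E _ _).
all: exact: branch_inv_J.
Qed.

Lemma finite_inner_cuts : finite_set inner_cuts.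
Proof. by rewrite /inner_cuts !finite_setU; do !split. Qed.

Lemma well_defined_system_N : @well_defined_system R 5 Nmx.
Proof.
split; [exact: real_mx_unit|exact: real_mx_preserves_Q| |].
  by apply/trivIsetP => i j _ _ ij; apply/seteqP; split => // p [/branch_arc_inj+ /[dup]];
    move=> /[apply] E; rewrite E eqxx in ij.
apply: (@sub_finite_set _ _ (param @` inner_cuts)).
  move=> p [pFA pN]; exists (conj_map p); last exact: param_conj_map.
  by apply: contrapT => /(FA_branch_arc pFA)[i ip]; apply: pN; exists i.
exact/finite_image/finite_inner_cuts.
Qed.

Lemma col3_hat (A : 'M[R]_3) p : let v := A *m col3 p.1 p.2 1 in
  v 2 0 != 0 -> col3 (hat A p).1 (hat A p).2 1 = (v 2 0)^-1 *: v.
Proof.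
move=> v v0.
have colZ (x y z : R) : z != 0 -> col3 (x / z) (y / z) 1 = z^-1 *: col3 x y z.
  move=> z0; apply/matrixP => i j; rewrite !mxE.
  by case: i => [[|[|[|//]]] ?] /=; rewrite mulrC// mulfV.
by rewrite colZ// -col3_eta.
Qed.

(** The vector built from [hat A p] is a nonzero multiple of A times the vector of p, and quotients
    of coordinates do not see the multiple. *)
Lemma hat_invmxK (A : 'M[R]_3) p : A \in unitmx ->
  (A *m col3 p.1 p.2 1) 2 0 != 0 -> hat (invmx A) (hat A p) = p.
Proof.
move=> Au v0; have E := col3_hat v0; move: v0; set v := A *m _ => v0.
rewrite /hat [in LHS]E -scalemxAr mulKmx//.
move: (v 2 0) v0 => z z0; rewrite !mxE /= mulr1 invrK.
by rewrite ![_^-1 * _]mulrC !mulfVK //; case: p {v E}.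
Qed.

Lemma hatT_param i s : J s ->
  hatT Nmx (param (branch_inv (rev_ord i) s)) = param s.
Proof.
move=> Js; rewrite /hatT; case: pickP => [j /asboolP jp|/(_ i)/asboolP[]]; last first.
  by apply/branch_arcP; exists s.
have ij : branch_arc Nmx i (param (branch_inv (rev_ord i) s)).
  by apply/branch_arcP; exists s.
rewrite (branch_arc_inj jp ij); have [v1 <-] := hat_param i Js.
by rewrite hat_invmxK ?real_mx_unit// gt_eqF// (lt_trans _ v1).
Qed.

Lemma homeomorphism_conj_map :
  homeomorphism_between (@FA R) (@J R) (@conj_map R) param.
Proof.
split.
- by split; [exact: conj_map_J|exact: FA_param].
- by move=> p /set_mem; exact: param_conj_map.
- by move=> t /set_mem; exact: conj_mapK_param.
- apply: continuous_in_subspaceT => -[x y] /set_mem[_ [/= yx x0]].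
  apply: cvgM; first by apply: cvgB; [exact: cvg_snd|exact: cvg_fst].
  apply: cvgV; first by rewrite /= gt_eqF// addr_gt0.
  by apply: cvgD; [exact: cvg_fst|exact: cvg_cst].
- apply: continuous_in_subspaceT => t /set_mem/J_sqr[t0 t3].
  have q0 : t ^+ 2 + 3 * t + 3 != 0 by rewrite gt_eqF//; nra.
  have cq : {for t, continuous (fun t => t ^+ 2 + 3 * t + 3)}.
    apply: cvgD; last exact: cvg_cst.
    by apply: cvgD; [exact: exprn_continuous|apply: cvgM; [exact: cvg_cst|exact: cvg_id]].
  apply: (@cvg_pair R R R (nbhs t) (nbhs (param t).1) (nbhs (param t).2) _ _ _
    (fun t => (3 - t ^+ 2) / (t ^+ 2 + 3 * t + 3))
    (fun t => (2 * t ^+ 2 + 6 * t + 3) / (t ^+ 2 + 3 * t + 3)));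
    apply: cvgM; try exact: cvgV.
    by apply: cvgB; [exact: cvg_cst|exact: exprn_continuous].
  apply: cvgD; last exact: cvg_cst.
  apply: cvgD; apply: cvgM; try exact: cvg_cst; [exact: exprn_continuous|exact: cvg_id].
Qed.

Lemma conjugate_T5 : conjugate_off_finite (@FA R)
  (\bigcup_i branch_arc Nmx i) (hatT Nmx) (@J R) (@T5_dom R) (@T5 R) (@conj_map R).
Proof.
exists param; first exact: homeomorphism_conj_map.
exists inner_cuts => [|t Jt tcut]; first exact: finite_inner_cuts.
have tdom := J_T5_dom Jt tcut.
have /T5_domP[i /(branch_inv_surj (R:=R))[s Js E]] := tdom.
split => //.
- by exists (rev_ord i) => //; apply/branch_arcP; exists s; rewrite // rev_ordK -E.
- by rewrite E -[i]rev_ordK hatT_param//; exact: FA_param.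
- by rewrite E -{2}[i]rev_ordK hatT_param// conj_mapK_param// T5_branch_inv.
Qed.

End one_dimensional_system_of_N.

(** * Descent on integer solutions *)

Section generating_system.
Variable R : realType.
Implicit Types (x y : 'cV[int]_3) (i : 'I_5).
Local Notation "n %:R'" := (n%:~R : R) (at level 1, format "n %:R'").

(** For b nonzero the exponent of 3 would be even on the left and odd on the right. *)
Lemma sqr_eq_3sqr (a b : int) : a ^+ 2 = 3 * b ^+ 2 -> b = 0.
Proof.
move=> /(congr1 absz); rewrite abszM !abszX (_ : absz 3 = 3%N)//.
have [->//|b0] := eqVneq b 0; have b1 : (0 < `|b|)%N by rewrite absz_gt0.
move: (absz a) (absz b) b1 => p q q0 /(congr1 (logn 3)).
rewrite lognM ?expn_gt0 ?q0// !lognX (_ : logn 3 3 = 1%N)//.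
by move: (logn 3 p) (logn 3 q) => u v; lia.
Qed.

(** At the irrational cuts, m = sqrt 3 (n - m) or 3 n - 2 m = sqrt 3 (m - n); by [sqr_eq_3sqr] this
    forces m = n, which is already the first alternative. *)
Lemma inner_cuts_rational (m n : int) : n != 0 ->
  inner_cuts (m%:R' / n%:R') -> m = n \/ 2 * m = 3 * n.
Proof.
move=> n0; have n0' : n%:R' != 0 by rewrite intr_eq0.
have w0 := @sqrt3_gt0 R; have w2 := @sqrt3_sqr R.
have sq (a b : int) : a%:R' = sqrt3 * b%:R' -> b = 0.
  move=> /(congr1 (fun z => z ^+ 2)); rewrite exprMn w2 => E.
  by apply: (@sqr_eq_3sqr a); apply: (@intr_inj R); rewrite rmorphXn rmorphM rmorphXn E.
have m_eq t : m%:R' / n%:R' = t -> m%:R' = t * n%:R'.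
  by move=> <-; rewrite mulfVK.
move=> [[[|]|]|] /m_eq E.
- have : (m%:R') = sqrt3 * (n - m)%:R'.
    by rewrite rmorphB /= E /cut1; field; nonzero.
  by move=> /sq/eqP; rewrite subr_eq0 => /eqP ->; left.
- by left; apply: (@intr_inj R); rewrite E mul1r.
- have : (3 * n - 2 * m)%:R' = sqrt3 * (m - n)%:R'.
    rewrite !rmorphB /= !rmorphM /= E /cut3.
    have w20 : 2 + sqrt3 != 0 :> R by nonzero.
    by apply: (mulIf w20); field: w2.
  by move=> /sq/eqP; rewrite subr_eq0 => /eqP ->; left.
- right; apply: (@intr_inj R); by rewrite !rmorphM /= E; field.
Qed.

Definition cone_solution x := Qform x = 0 /\ cone x.

(** The point of the affine conic represented by x, in the chart where the third coordinate is 1. *)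
Definition slopes x : R * R := ((x 0 0)%:R' / (x 2 0)%:R', (x 1 0)%:R' / (x 2 0)%:R').

Lemma map_col3_slopes x : 0 < x 2 0 -> map_mx intr x =
  (x 2 0)%:R' *: col3 (slopes x).1 (slopes x).2 1.
Proof.
move=> x2; rewrite {1}[x]col3_eta; apply/matrixP => i j; rewrite !mxE /=.
by case: i => [[|[|[|//]]] ?] /=; rewrite ?mulr1// mulrC mulfVK// intr_eq0 gt_eqF.
Qed.

Lemma Qform_intr x : (Qform x)%:R' = (x 0 0)%:R' ^+ 2 +
  (x 0 0)%:R' * (x 1 0)%:R' + (x 1 0)%:R' ^+ 2 - 3 * (x 2 0)%:R' ^+ 2.
Proof. by rewrite /Qform rmorphB !rmorphD !rmorphXn rmorphM rmorphM rmorphXn. Qed.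

Lemma cone_solutionP x : cone_solution x <-> 0 < x 2 0 /\ FA (slopes x).
Proof.
have QE (z : R) : z != 0 -> Qform (col3 ((x 0 0)%:R' / z) ((x 1 0)%:R' / z) 1) * z ^+ 2 =
    (x 0 0)%:R' ^+ 2 + (x 0 0)%:R' * (x 1 0)%:R' + (x 1 0)%:R' ^+ 2 - 3 * z ^+ 2.
  by move=> z0; rewrite /Qform !col3E; field.
rewrite /cone_solution /cone /FA /=; split=> [[Qx [x10 [x0 x2]]]|[x2 [Qx [x10 x0]]]];
  have z0 : (x 2 0)%:R' != 0 by rewrite intr_eq0 gt_eqF.
- have z1 : (x 2 0)%:R' > 0 by rewrite ltr0z.
  split=> //; split; last by rewrite divr_gt0 ?ltr0z// ltr_pM2r ?invr_gt0// ltr_int.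
  apply: (@mulIf _ ((x 2 0)%:R' ^+ 2)); first by rewrite expf_neq0.
  rewrite QE// mul0r; by rewrite -Qform_intr Qx.
- have z1 : (x 2 0)%:R' > 0 by rewrite ltr0z.
  move: x10 x0; rewrite ltr_pM2r ?invr_gt0// pmulr_lgt0 ?invr_gt0// ltr_int ltr0z.
  move=> x10 x0; do !split => //.
  apply: (@intr_inj R); rewrite Qform_intr.
  by rewrite -QE// Qx mul0r.
Qed.

(** A common divisor of x divides all coordinates of A x. Used with a generator and with its
    integral inverse, this carries primitivity both ways. *)
Lemma primitive_mulmx (A : 'M[int]_3) x : primitive (A *m x) -> primitive x.
Proof.
move=> + d d1 dx => /(_ d d1); apply => i; rewrite mxE.
by apply: rpred_sum => j _; apply: dvdz_mull.
Qed.

(** y is y_3 times the vector of its point on the arc, so the bound 1 < v_3 of [hat_param] becomes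
    growth of the third coordinate. *)
Lemma Nmx_cone_solution i y : cone_solution y ->
  [/\ cone_solution (Nmx i *m y), branch_arc Nmx i (slopes (Nmx i *m y)) &
      y 2 0 < (Nmx i *m y) 2 0].
Proof.
move=> /cone_solutionP[y2 yFA].
have Js := conj_map_J yFA; have [] := hat_param i Js.
rewrite param_conj_map//; set v := _ *m _ => v1 hatE.
have yE : map_mx intr (Nmx i *m y) = (y 2 0)%:R' *: v.
  by rewrite map_mxM map_col3_slopes// -scalemxAr.
have y2' : ((Nmx i *m y) 2 0)%:R' = (y 2 0)%:R' * v 2 0.
  by have /matrixP/(_ 2 0) := yE; rewrite [LHS]mxE [RHS]mxE.
have lt2 : y 2 0 < (Nmx i *m y) 2 0.
  by rewrite -(ltr_int R) y2' ltr_pMr// ltr0z.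
have slE : slopes (Nmx i *m y) = hat (real_mx Nmx i) (slopes y).
  have /matrixP vE := yE; have y0 : (y 2 0)%:R' != 0 by rewrite intr_eq0 gt_eqF.
  have aE a : ((Nmx i *m y) a 0)%:R' = (y 2 0)%:R' * v a 0.
    by have := vE a 0; rewrite [LHS]mxE [RHS]mxE.
  by rewrite /slopes !aE -!mulf_div mulfV// !mul1r.
have arc : branch_arc Nmx i (slopes (Nmx i *m y)).
  by rewrite slE hatE; apply/branch_arcP; exists (conj_map (slopes y)).
split=> //; apply/cone_solutionP; split; first exact: lt_trans lt2.
by case: arc.
Qed.

(** If the point of x is the image of q under N_i, then N_i^-1 x is a positive multiple of (q, 1)
    and lies over q. *)
Lemma Nmx_cone_solution_inv i x : cone_solution x ->
  branch_arc Nmx i (slopes x) -> cone_solution (invmx (Nmx i) *m x).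
Proof.
move=> /cone_solutionP[x2 xFA] [_ [q qFA hq]].
have [v1 _] := hat_param i (conj_map_J qFA).
rewrite param_conj_map// in v1.
set v := _ *m _ in v1; have v0 : 0 < v 2 0 by exact: lt_trans v1.
have xE : map_mx intr x = real_mx Nmx i *m (((x 2 0)%:R' / v 2 0) *: col3 q.1 q.2 1).
  rewrite map_col3_slopes// -hq col3_hat ?gt_eqF// scalerA.
  by rewrite -scalemxAr.
have yE : map_mx intr (invmx (Nmx i) *m x) = ((x 2 0)%:R' / v 2 0) *: col3 q.1 q.2 1.
  rewrite map_mxM; apply: (can_inj (mulKmx (real_mx_unit i))); rewrite -xE.
  by rewrite mulmxA -map_mxM mulmxV ?Nmx_unit// map_mx1 mul1mx.
have yaE a : ((invmx (Nmx i) *m x) a 0)%:R' = ((x 2 0)%:R' / v 2 0) * col3 q.1 q.2 1 a 0.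
  by have /matrixP/(_ a 0) := yE; rewrite [LHS]mxE [RHS]mxE.
have k0 : 0 < (x 2 0)%:R' / v 2 0 by rewrite divr_gt0// ltr0z.
apply/cone_solutionP; split; first by rewrite -(ltr0z R) yaE col3E mulr1.
suff -> : slopes (invmx (Nmx i) *m x) = q by [].
rewrite /slopes !yaE !col3E mulr1 ![_ / _ * _]mulrC !mulfK ?gt_eqF//.
by case: q {hq qFA v v1 v0 xE yE yaE k0}.
Qed.

(** The parameters are (11 - 2) / (2 + 7) = 1 and (22 - 1) / (1 + 13) = 3/2, the two rational
    cuts. *)
Lemma base_triplesP x : x \in base_triples ->
  [/\ cone_solution x, primitive x & inner_cuts (conj_map (slopes x))].
Proof.
rewrite !inE => /orP[]/eqP ->; rewrite /cone_solution /slopes /conj_map /Qform /cone /=.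
all: rewrite !col3E /primitive; split.
- by do !split.
- move=> d d1 /[dup] /(_ 0) + /(_ 1); rewrite !col3E => d2 d11.
  have : (d %| 11 - 2 * 5)%Z by rewrite rpredB// dvdz_mulr.
  by rewrite dvdz1 => /eqP dE; move: d1; lia.
- by left; left; right; field.
- by do !split.
- by move=> d d1 /(_ 0); rewrite col3E dvdz1 => /eqP dE; lia.
- by right; field.
Qed.

Lemma primitive_scale (k a b c : int) x : 0 < k -> primitive x ->
  x = k *: col3 a b c -> x = col3 a b c.
Proof.
move=> k0 xp xE; have [k1|k1] := ltP 1 k.
  by case: (xp k k1) => i; rewrite xE mxE dvdz_mulr.
by rewrite xE (_ : k = 1) ?scale1r//; lia.
Qed.

(** A rational cut expresses x_3 linearly in x_1 and x_2. Substituted into Q = 0 this leaves a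
    product of two linear forms, and the factor x_1 - x_2 is nonzero in the cone. *)
Lemma inner_cuts_base x : cone_solution x -> primitive x ->
  inner_cuts (conj_map (slopes x)) -> x \in base_triples.
Proof.
move=> [Qx [x10 [x0 x2]]] xp.
have -> : conj_map (slopes x) = (x 1 0 - x 0 0)%:R' / (x 0 0 + x 2 0)%:R'.
  rewrite /conj_map /slopes /= rmorphB rmorphD /=.
  have : 0 < (x 0 0)%:R' by rewrite ltr0z.
  have : 0 < (x 2 0)%:R' by rewrite ltr0z.
  move: ((x 0 0)%:R') ((x 1 0)%:R') ((x 2 0)%:R') => a b c c0 a0.
  by field; nonzero.
move=> /inner_cuts_rational; rewrite gt_eqF ?addr_gt0//.
move=> /(_ isT); have xE := col3_eta x; move: Qx; rewrite /Qform.
move: (x 0 0) (x 1 0) (x 2 0) x10 x0 x2 xE => a b c ab a0 c0 xE Qx.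
rewrite /base_triples !inE; case=> E.
- have ab0 : (11 * a - 2 * b) * (a - b) = 0.
    by rewrite (_ : c = b - 2 * a) in Qx; [rewrite -[RHS]oppr0 -Qx; ring|lia].
  have {}ab0 : 11 * a = 2 * b by move/eqP: ab0; rewrite mulf_eq0 => /orP[]/eqP; lia.
  (* From 11 a = 2 b, the integer b - 5 a equals a / 2, the factor by which x exceeds (2, 11, 7). *)
  apply/orP; left; apply/eqP; apply: (@primitive_scale (b - 5 * a)) => //; first lia.
  rewrite xE; apply/matrixP => i j; rewrite !mxE.
  by case: i => [[|[|[|//]]] ?] /=; lia.
- have ab0 : (22 * a - b) * (a - b) = 0.
    (* Q = 0 is tripled because 3 c, rather than c, is an integral linear form in a and b. *)
    have : 3 * (a ^+ 2 + a * b + b ^+ 2) = (3 * c) ^+ 2.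
      by apply/eqP; rewrite -subr_eq0 -[_ - _]mulr1 -(mulr0 3) -Qx; apply/eqP; ring.
    rewrite (_ : 3 * c = 2 * b - 5 * a); last by lia.
    move=> /eqP; rewrite -subr_eq0 => /eqP E'; rewrite -[RHS]oppr0 -E'; ring.
  have {}ab0 : b = 22 * a by move/eqP: ab0; rewrite mulf_eq0 => /orP[]/eqP; lia.
  apply/orP; right; apply/eqP; apply: (@primitive_scale a) => //.
  rewrite xE; apply/matrixP => i j; rewrite !mxE.
  by case: i => [[|[|[|//]]] ?] /=; lia.
Qed.

Lemma word_value_cons i (u : seq 'I_5) b :
  word_value Nmx (i :: u) b = Nmx i *m word_value Nmx u b.
Proof. by rewrite /word_value big_cons mulmxA. Qed.

Lemma word_value_nil b : word_value Nmx [::] b = b.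
Proof. by rewrite /word_value big_nil mul1mx. Qed.

Lemma word_value_cone_solution (u : seq 'I_5) b : b \in base_triples ->
  cone_solution (word_value Nmx u b) /\ primitive (word_value Nmx u b).
Proof.
move=> /base_triplesP[bs bp _]; elim: u => [|i u [IHs IHp]].
  by rewrite word_value_nil.
rewrite word_value_cons; have [? _ _] := Nmx_cone_solution i IHs; split=> //.
by apply: (@primitive_mulmx (invmx (Nmx i))); rewrite mulKmx// Nmx_unit.
Qed.

Lemma cone_solution_word x : cone_solution x -> primitive x ->
  exists u b, b \in base_triples /\ x = word_value Nmx u b.
Proof.
(* Descent on the third coordinate, which stays positive under the inverse step. *)
have [n] := ubnP (absz (x 2 0)); elim: n x => // n IH x xn xs xp.
have [/(inner_cuts_base xs xp) xb|xN] := pselect (inner_cuts (conj_map (slopes x))).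
  by exists [::], x; rewrite word_value_nil.
have /cone_solutionP[_ xFA] := xs.
have [i xi] := FA_branch_arc xFA xN.
have ys := Nmx_cone_solution_inv xs xi.
have xE : x = Nmx i *m (invmx (Nmx i) *m x) by rewrite mulKVmx// Nmx_unit.
have [_ _ lt2] := Nmx_cone_solution i ys; rewrite -xE in lt2.
have [|||u [b [bb E]]] := IH (invmx (Nmx i) *m x) => //.
- case: ys => _ [_ [_]]; move: lt2 xn {xE IH xi}.
  by move: (x 2 0) ((invmx (Nmx i) *m x) 2 0) => m k; lia.
- by apply: (@primitive_mulmx (Nmx i)); rewrite -xE.
by exists (i :: u), b; rewrite word_value_cons -E -xE.
Qed.

(** A nonempty word puts the parameter strictly between two cuts, whereas a base triple sits at a
    cut. *)
Lemma word_value_base (u : seq 'I_5) i b b' : b \in base_triples -> b' \in base_triples ->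
  b' <> word_value Nmx (i :: u) b.
Proof.
move=> bb /base_triplesP[_ _] + E; rewrite E word_value_cons.
have [us _] := word_value_cone_solution u bb.
have [_ /branch_arcP[s Js ->] _] := Nmx_cone_solution i us.
rewrite conj_mapK_param; last exact: branch_inv_J.
apply: T5_dom_inner_cuts; apply/T5_domP; exists (rev_ord i); exact: branch_inv_itv.
Qed.

Lemma generating_system : matrix_generating_system Nmx base_triples Qform cone.
Proof.
split=> [x|].
  split=> [[Qx xp Fx]|[u [b [/(word_value_cone_solution u)[[? ?] ?] ->]]]//].
  exact: cone_solution_word.
(* Uniqueness: the arc containing the point determines the first letter, which is then cancelled. *)
elim=> [|i u IH] [|j v] b b' bb bb'.
- by rewrite !word_value_nil.
- by rewrite word_value_nil => /(word_value_base bb' bb).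
- by rewrite word_value_nil => /esym/(word_value_base bb bb').
have [us _] := word_value_cone_solution u bb.
have [vs _] := word_value_cone_solution v bb'.
rewrite !word_value_cons => E.
have [_ ui _] := Nmx_cone_solution i us; have [_ vj _] := Nmx_cone_solution j vs.
rewrite E in ui; have ij := branch_arc_inj ui vj; subst j.
have := can_inj (mulKmx (Nmx_unit i)) E => /IH[]// -> ->.
by [].
Qed.

End generating_system.

(** * Expanding maps and Lebesgue measure *)

Section lebesgue_outer.
Context {R : realType}.
Local Notation leb := (@lebesgue_measure R).
Implicit Types A B : set R.
Local Open Scope ereal_scope.

Lemma lebesgue_le A B : A `<=` B -> leb A <= leb B.
Proof. by move=> AB; apply: le_mu_ext. Qed.

Lemma lebesgue_ge0 A : 0 <= leb A.
Proof. by apply: mu_ext_ge0 => X; exact: wlength_ge0. Qed.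

(** Valid for arbitrary sets, as [lebesgue_measure] is an outer measure on them. A cover of B by
    intervals pulls back to a cover of A by sets of controlled diameter. *)
Lemma lebesgue_expanding (f : R -> R) (c : R) A B : (0 < c)%R ->
  (forall s, A s -> B (f s)) ->
  (forall s t, A s -> A t -> `|s - t| <= c * `|f s - f t|)%R ->
  leb A <= (2 * c)%:E * leb B.
Proof.
move=> c0 AB fexp; rewrite -lee_pdivrMl ?mulr_gt0//.
apply/ereal_infP => _ [F [mF BF] <-].
rewrite lee_pdivrMl ?mulr_gt0// -nneseriesZl; last first.
  by move=> n _; exact: wlength_ge0.
have AG : A `<=` \bigcup_n (A `&` f @^-1` F n).
  by move=> s As; have [n _ Fn] := BF _ (AB _ As); exists n.
apply: (le_trans (lebesgue_le AG)).
apply: (le_trans (mu_ext_sigma_subadditive _ _)) => [X|]; first exact: wlength_ge0.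
apply: lee_nneseries => [n _ _|n _].
  by apply: mu_ext_ge0 => X; exact: wlength_ge0.
have [->|/set0P[s0 [As0]]] := eqVneq (A `&` f @^-1` F n) set0.
  rewrite -[mu_ext _ _]/(leb _) measure0; apply: mule_ge0.
    by rewrite lee_fin mulr_ge0// ltW.
  exact: wlength_ge0.
have [->//|[[a b]/= ab ->] fs0] := (ocitvP (F n)).1 (mF n).
rewrite wlength_itv /= lte_fin ab.
(* The piece has diameter at most c (b - a); an interval centred at one of its points needs this as
   radius, whence the factor 2. *)
have sub : A `&` f @^-1` `]a, b]%classic `<=`
    `[(s0 - c * (b - a))%R, (s0 + c * (b - a))%R]%classic.
  move=> s [As fs]; rewrite /= in_itv /= -ler_distlC.
  rewrite (le_trans (fexp _ _ As0 As))// ler_pM2l//.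
  move: fs fs0; rewrite /= !in_itv /= => /andP[? ?] /andP[? ?].
  by rewrite ler_norml; lra.
apply: (le_trans (lebesgue_le sub)).
have d0 : (0 < c * (b - a))%R by rewrite mulr_gt0// subr_gt0.
by rewrite lebesgue_measure_itv /= lte_fin; case: ifPn => _;
  rewrite -?EFinD -?EFinM lee_fin; lra.
Qed.

End lebesgue_outer.

(** * Inverse branches of the iterates as Moebius maps *)

Section inverse_branches_of_iterates.
Context {R : realType}.
Implicit Types (s t : R) (i : 'I_5) (f : R -> R).
Local Notation T := (@T5 R).
Local Notation X0 := (iterable (@T5_dom R) T).

Lemma T5_J t : T5_dom t -> J (T t).
Proof. by move=> /T5_domP[i /(branch_inv_surj (R:=R))[s Js ->]]; rewrite T5_branch_inv. Qed.

Lemma iterable_dom t : X0 t -> T5_dom t.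
Proof. by move=> /(_ 0%N). Qed.

Lemma iterable_J t : X0 t -> J t.
Proof. by move=> /iterable_dom/T5_dom_J. Qed.

Lemma iterable_iter n t : X0 t -> X0 (iter n T t).
Proof. by move=> Xt m; rewrite -iterD; exact: Xt. Qed.

(* The second clause says that [f] is a Moebius transformation of determinant
   [D] and denominator [c * s + d] without mentioning its numerator; the third
   that [L] bounds its derivative. *)
Definition iterate_branch (n : nat) (L D c d : R) f :=
  [/\ [/\ 0 <= c, 0 <= d, 0 < c + d & D != 0],
      forall s t, J s -> J t ->
        f s - f t = D * (s - t) / ((c * s + d) * (c * t + d)),
      forall s t, J s -> J t -> `|D| <= L * ((c * s + d) * (c * t + d)) &
      forall s, J s -> J (f s) /\ iter n T (f s) = s].

Lemma iterate_branch_id : iterate_branch 0 1 1 0 1 id.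
Proof.
split; first by rewrite oner_neq0; split=> //; lra.
- by move=> s t _ _; rewrite !mul0r !add0r !mulr1 divr1 mul1r.
- by move=> s t _ _; rewrite normr1 !mul0r !add0r !mulr1.
- by [].
Qed.

(** A bound for the derivative of [branch_inv i] on J. Branch 0 has a neutral fixed point at 0, with
    derivative 1. *)
Definition contraction (i : nat) : R := if i is 0%N then 1 else 3^-1.

Lemma branch_inv_moebius i : exists a b c d : R,
  [/\ [/\ 0 <= a, 0 <= b, 0 <= c & 0 <= d], 0 < a + b /\ 0 < c + d,
      a * d - b * c != 0,
      forall s, J s -> branch_inv i s = (a * s + b) / (c * s + d) &
      forall s t, J s -> J t ->
        `|a * d - b * c| <= contraction i * ((c * s + d) * (c * t + d))].
Proof.
elim/I5_ind: i.
- exists 1, 0, 1, 1; split.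
  + by split; lra.
  + by split; lra.
  + by nonzero.
  + by move=> s _; rewrite /= mul1r addr0 [1 + s]addrC.
  + by move=> s t /J_itv[? _] /J_itv[? _]; rewrite ger0_norm /contraction /=; nra.
- exists 0, 3, 1, 3; split.
  + by split; lra.
  + by split; lra.
  + by nonzero.
  + by move=> s _; rewrite /= mul0r add0r mul1r.
  + by move=> s t /J_itv[? _] /J_itv[? _]; rewrite ler0_norm /contraction /=; nra.
- exists 3, 3, 2, 3; split.
  + by split; lra.
  + by split; lra.
  + by nonzero.
  + by move=> s _; rewrite /= [3 + _]addrC.
  + by move=> s t /J_itv[? _] /J_itv[? _]; rewrite ger0_norm /contraction /=; nra.
- exists 1, 3, 1, 2; split.
  + by split; lra.
  + by split; lra.
  + by nonzero.
  + by move=> s _; rewrite /= !mul1r.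
  + by move=> s t /J_itv[? _] /J_itv[? _]; rewrite ler0_norm /contraction /=; nra.
- exists 2, 3, 1, 2; split.
  + by split; lra.
  + by split; lra.
  + by nonzero.
  + by move=> s _; rewrite /= !mul1r.
  + by move=> s t /J_itv[? _] /J_itv[? _]; rewrite ger0_norm /contraction /=; nra.
Qed.

Lemma affine_gt0 (c d s : R) : 0 <= c -> 0 <= d -> 0 < c + d -> 0 < s -> 0 < c * s + d.
Proof.
move=> c0 d0 cd s0; have [c1|c1] := ltP 0 c; first by rewrite ltr_wpDr ?mulr_gt0.
by rewrite ltr_wpDl ?mulr_ge0 ?(ltW s0)//; lra.
Qed.

(** Determinants multiply, and the composite denominator at s is that of f at [branch_inv i s] times
    that of [branch_inv i] at s; hence the derivative bounds multiply too. *)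
Lemma iterate_branch_comp n L D c d f i : iterate_branch n L D c d f ->
  exists D' c' d', iterate_branch n.+1 (L * contraction i) D' c' d' (f \o branch_inv i).
Proof.
move=> [[c0 d0 cd D0] fE fL fT].
have [a' [b' [c' [d' [[a0' b0' c0' d0'] [ab' cd'] D0' SE SL]]]]] := branch_inv_moebius i.
have g0 s : J s -> 0 < c' * s + d' by move=> /J_itv[s0 _]; exact: affine_gt0.
have q0 s : J s -> 0 < c * s + d by move=> /J_itv[s0 _]; exact: affine_gt0.
have qE s : J s -> (c * a' + d * c') * s + (c * b' + d * d') =
    (c * branch_inv i s + d) * (c' * s + d').
  by move=> Js; rewrite SE//; field; have := g0 _ Js; rewrite lt0r => /andP[].
have JS s := @branch_inv_J R i s.
exists (D * (a' * d' - b' * c')), (c * a' + d * c'), (c * b' + d * d'); split.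
- split; rewrite ?addr_ge0 ?mulr_ge0// ?mulf_neq0//.
  rewrite addrACA -!mulrDr; have [c1|c1] := ltP 0 c.
    by rewrite ltr_wpDr ?mulr_gt0// mulr_ge0// ltW.
  by rewrite ltr_wpDl ?mulr_ge0 ?(ltW ab')// mulr_gt0//; lra.
- move=> s t Js Jt; rewrite !qE// fE; [|exact: JS|exact: JS].
  have [/lt0r_neq0 ? /lt0r_neq0 ?] := (q0 _ (JS _ Js), q0 _ (JS _ Jt)).
  have [/lt0r_neq0 gs /lt0r_neq0 gt] := (g0 _ Js, g0 _ Jt).
  rewrite (_ : branch_inv i s - branch_inv i t =
    (a' * d' - b' * c') * (s - t) / ((c' * s + d') * (c' * t + d'))); last first.
    by rewrite !SE//; field; do ?(apply/andP; split).
  by field; do ?(apply/andP; split).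
- move=> s t Js Jt; rewrite !qE// normrM.
  apply: (le_trans (ler_pM _ _ (fL _ _ (JS _ Js) (JS _ Jt)) (SL _ _ Js Jt))) => //.
  by rewrite le_eqVlt; apply/orP; left; apply/eqP; ring.
- move=> s Js; have [Jf Tf] := fT _ (JS _ Js); split => //=.
  by rewrite Tf T5_branch_inv.
Qed.

End inverse_branches_of_iterates.

(** * Recurrence of orbits *)

Section recurrence.
Context {R : realType}.
Implicit Types (s t x : R) (i : 'I_5) (f : R -> R) (A B C : set R).
Local Notation T := (@T5 R).
Local Notation X0 := (iterable (@T5_dom R) T).
Local Notation leb := (@lebesgue_measure R).

Lemma iterable_branch x : X0 x ->
  exists i, [/\ branch_cut i < x < branch_cut i.+1, J (T x) &
    x = branch_inv i (T x)].
Proof.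
move=> /iterable_dom/T5_domP[i xi]; have [s Js E] := branch_inv_surj xi.
by exists i; rewrite E T5_branch_inv// -E.
Qed.

(* Below [cut1] the map acts as [t^-1 |-> t^-1 - 1]. *)
Lemma iterable_return x : X0 x -> exists m, cut1 < iter m T x.
Proof.
move=> Xx; apply: contrapT => /forallNP noret.
have inv_iter m : 0 < iter m T x /\ (iter m T x)^-1 = x^-1 - m%:R.
  elim: m => [|m [y0 yE]].
    by rewrite subr0; have /iterable_J/J_itv[] := Xx.
  have [i []] := iterable_branch (iterable_iter m Xx).
  rewrite -iterS => /andP[lo _] /J_itv[s0 _] E; split=> //.
  have i0 : i = 0%N :> nat.
    apply: contra_notP (noret m) => /eqP; rewrite -lt0n => i0.
    by apply: le_lt_trans lo; rewrite (@branch_cut_mono R 1 i)// i0 ltnW/=.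
  move: yE; rewrite {1}E i0 /= invf_div -[m.+1]addn1 natrD => yE.
  rewrite opprD addrA -yE; field; nonzero.
have [] := inv_iter (Num.bound x^-1); rewrite -invr_gt0 => + E; rewrite E subr_gt0.
have /iterable_J/J_itv[x0 _] := Xx.
by rewrite ltNge ltW// archi_boundP// invr_ge0 ltW.
Qed.

Definition branch_through x n (L D c d : R) f :=
  iterate_branch n L D c d f /\ f (iter n T x) = x.

Lemma branch_through_step x n L D c d f : X0 x -> branch_through x n L D c d f ->
  exists i D' c' d' f', branch_cut i < iter n T x < branch_cut i.+1 /\
    branch_through x n.+1 (L * contraction i) D' c' d' f'.
Proof.
move=> Xx [bf fx]; have [i [lohi _ E]] := iterable_branch (iterable_iter n Xx).
have [D' [c' [d' bf']]] := iterate_branch_comp i bf.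
exists i, D', c', d', (f \o branch_inv i); split=> //; split=> //.
by rewrite /= -E.
Qed.

(** Steps below [cut1] use branch 0, whose constant is 1, so L survives until the orbit is back
    above [cut1]. *)
Lemma branch_through_return x n L D c d f : X0 x -> branch_through x n L D c d f ->
  exists n' D' c' d' f', branch_through x n' L D' c' d' f' /\ cut1 < iter n' T x.
Proof.
move=> Xx; have [m] := iterable_return (iterable_iter n Xx).
elim: m n D c d f => [|m IH] n D c d f ret bf; first by exists n, D, c, d, f.
have [big|small] := ltP cut1 (iter n T x); first by exists n, D, c, d, f.
have [i [D' [c' [d' [f' [/andP[lo _]]]]]]] := branch_through_step Xx bf.
have -> : i = 0%N :> nat.
  apply: contraTeq small; rewrite -lt0n -ltNge => i0.
  by apply: le_lt_trans lo; rewrite (@branch_cut_mono R 1 i)// i0 ltnW/=.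
by rewrite mulr1; apply: IH; rewrite iterS -iterSr.
Qed.

(** A step from above [cut1] uses a branch other than 0 and gains a factor 1/3; the orbit then
    returns above [cut1] at no cost. *)
Lemma branch_through_contracting x k : X0 x ->
  exists n D c d f, branch_through x n (3^-1 ^+ k) D c d f /\ cut1 < iter n T x.
Proof.
move=> Xx; elim: k => [|k [n [D [c [d [f [bf big]]]]]]].
  by apply: (@branch_through_return x 0 1 1 0 1 id) => //; split=> //; exact: iterate_branch_id.
have [i [D' [c' [d' [f' [/andP[_ hi] bf']]]]]] := branch_through_step Xx bf.
have ci : contraction i = 3^-1 :> R.
  rewrite /contraction; case: (nat_of_ord i) hi => //= hi.
  by have := lt_trans big hi; rewrite ltxx.
by rewrite ci -exprSr in bf'; exact: branch_through_return bf'.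
Qed.

(** Bounded distortion: since 1/2 < s < 2, the denominator varies by a factor of at most 4,
    uniformly over all iterated branches. *)
Lemma branch_inv_moebius_bounds (c d s : R) : 0 <= c -> 0 <= d ->
  J s -> cut1 < s -> c / 2 + d <= c * s + d <= 4 * (c / 2 + d).
Proof.
move=> c0 d0 /J_itv[_ sw] s1; have /andP[w1 w2] := @sqrt3_bounds R.
have : 1 / 2 < s.
  by apply: lt_trans s1; rewrite /cut1 ltr_pdivlMr; lra.
by move=> ?; apply/andP; split; nra.
Qed.

(** The Lebesgue density theorem for the complement of B, at a point of B outside the exceptional
    null set. *)
Lemma density_point B : measurable B -> leb B != 0%E ->
  exists2 x, B x & forall e : R, 0 < e -> exists2 rho : R, 0 < rho &
    forall r, 0 < r < rho -> (leb (~` B `&` ball x r) <= (e * (r *+ 2))%:E)%E.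
Proof.
move=> mB B0; have [N [mN N0 sub]] := lebesgue_density (measurableC mB).
have [x [Bx Nx]] : exists x, B x /\ ~ N x.
  apply: contrapT => /forallNP BN; case/eqP: B0; apply/negligibleP => //.
  by exists N; split=> // x Bx; apply: contrapT => Nx; exact: (BN x).
exists x => // e e0; have /contrapT := contra_not (@sub x) Nx.
rewrite /= indicE (_ : x \in ~` B = false); last by apply/negbTE; rewrite notin_setE => /(_ Bx).
move=> /(_ _ (@nbhs_open_ereal_lt R 0 (fun=> e) e0)) /nbhs_ballP[rho /= rho0 H].
exists rho => // r /andP[r0 rr].
have /H/(_ r0) : ball 0 rho r by rewrite /ball /= sub0r normrN gtr0_norm.
rewrite /= lebesgue_measure_ball ?(ltW r0)// inver mulrn_eq0/= gt_eqF//.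
by rewrite -lte_pdivlMr ?invr_gt0 ?mulrn_wgt0// invrK -EFinM => /ltW.
Qed.

(** By contradiction: a branch f through a density point x of B maps C into the complement of B near
    x. That complement is relatively small at the scale of f, and expanding back makes the measure
    of C arbitrarily small. *)
Lemma visits B C : measurable B -> B `<=` X0 -> leb B != 0%E ->
  (forall s, C s -> J s /\ cut1 < s) -> leb C != 0%E ->
  exists x n, B x /\ C (iter n T x).
Proof.
move=> mB BX B0 CV C0; apply: contrapT => nohit.
have [x Bx dens] := density_point mB B0; case/eqP: C0.
apply/eqP; rewrite eq_le; apply/andP; split; last exact: lebesgue_ge0.
apply/lee_addgt0Pr => e e0; rewrite add0e.
(* 128 is the product of 2 from [lebesgue_expanding], the distortion 16, 2 from the length 2 r of
   the ball, and 2 from the definition of r. *)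
have e1 : 0 < e / 128 by rewrite divr_gt0.
have [rho rho0 {}dens] := dens _ e1.
(* The radius r below is at most 4 L with L = 3^-k. *)
have [k kE] : exists k, 4 * 3^-1 ^+ k < rho.
  exists (Num.bound (4 / rho)); set k := Num.bound _.
  rewrite exprVn ltr_pdivrMr ?exprn_gt0// mulrC -ltr_pdivrMr//.
  apply: (lt_le_trans (archi_boundP _)); first by rewrite divr_ge0// ltW.
  by rewrite -/k -natrX ler_nat ltnW// ltn_expl.
have Xx := BX _ Bx.
have [n [D [c [d [f [[[[c0 d0 cd D0] fE fL fT] fx] big]]]]]] := branch_through_contracting k Xx.
set L := _ ^+ k in fL kE; set y := iter n T x in fx big.
have Jy : J y by apply: iterable_J; exact: iterable_iter.
have D1 : 0 < `|D| by rewrite normr_gt0.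
set Q := c / 2 + d; have Q0 : 0 < Q.
  by rewrite /Q; have [c1|c1] := ltP 0 c; lra.
have qV s : J s -> cut1 < s -> Q <= c * s + d <= 4 * Q.
  exact: branch_inv_moebius_bounds.
(* Above [cut1], f stretches distances by at most |D| / Q^2, and points there are less than 2
   apart. *)
set r := 2 * `|D| / Q ^+ 2.
have Q2 : 0 < Q ^+ 2 by rewrite exprn_gt0.
have r0 : 0 < r by rewrite divr_gt0// mulr_gt0.
have rrho : r < rho.
  apply: le_lt_trans kE; rewrite /r ler_pdivrMr//.
  have /andP[w1 w2] := @sqrt3_bounds R.
  (* The derivative bound is taken at 1 and 1/2: the denominator is Q at 1/2 and at most 2 Q at
     1. *)
  have J1 : J (1 : R) by apply/J_itv; lra.
  have J2 : J (2^-1 : R) by apply/J_itv; lra.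
  have := fL _ _ J1 J2; rewrite -/Q mulr1 => DL.
  have L0 : 0 < L by rewrite exprn_gt0.
  have : L * ((c + d) * Q) <= L * ((2 * Q) * Q).
    by rewrite ler_pM2l// ler_pM2r// /Q; lra.
  by rewrite expr2; lra.
have fdist s t : J s -> J t -> cut1 < s -> cut1 < t ->
    `|D| * `|s - t| / (16 * Q ^+ 2) <= `|f s - f t| <= `|D| * `|s - t| / Q ^+ 2.
  move=> Js Jt s1 t1; rewrite fE// normrM normfV normrM.
  have [/andP[qs1 qs2] /andP[qt1 qt2]] := (qV _ Js s1, qV _ Jt t1).
  have qst : Q ^+ 2 <= (c * s + d) * (c * t + d) <= 16 * Q ^+ 2.
    rewrite expr2 ler_pM ?(ltW Q0)//=.
    apply: (@le_trans _ _ ((4 * Q) * (4 * Q))); last by lra.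
    by rewrite ler_pM// (le_trans (ltW Q0)).
  case/andP: qst => q1 q2; have q0 := lt_le_trans Q2 q1.
  by rewrite (gtr0_norm q0) !ler_wpM2l ?mulr_ge0// lef_pV2 ?posrE// mulr_gt0.
have fC s : C s -> (~` B `&` ball x r) (f s).
  move=> Cs; have [Js s1] := CV _ Cs; split.
    (* f s reaches s in C after n steps, so [nohit] keeps it out of B. *)
    by move=> Bf; apply: nohit; exists (f s), n; split=> //; rewrite (fT _ Js).2.
  rewrite /ball /= -{1}fx; have /andP[_ /le_lt_trans] := fdist _ _ Jy Js big s1.
  apply; rewrite /r ltr_pM2r ?invr_gt0// mulrC ltr_pM2r//.
  move/J_itv: Jy => [y0 yw]; move/J_itv: Js => [s0 sw].
  have /andP[w1 w2] := @sqrt3_bounds R.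
  by rewrite ltr_norml; lra.
have c1 : 0 < 16 * Q ^+ 2 / `|D| by rewrite divr_gt0// mulr_gt0.
apply: (le_trans (lebesgue_expanding c1 fC _)).
  move=> s t Cs Ct; have [Js s1] := CV _ Cs; have [Jt t1] := CV _ Ct.
  have /andP[+ _] := fdist _ _ Js Jt s1 t1.
  rewrite ler_pdivrMr ?mulr_gt0// => H.
  by rewrite mulrAC ler_pdivlMr// mulrC (le_trans H)// mulrC.
have rr : 0 < r < rho by rewrite r0.
apply: (le_trans (lee_wpmul2l _ (dens _ rr))); first by rewrite lee_fin mulr_ge0// ltW.
rewrite -EFinM lee_fin le_eqVlt; apply/orP; left; apply/eqP.
by rewrite /r; field; rewrite !gt_eqF.
Qed.

End recurrence.

(** * Ergodicity, conservativity and invariance *)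

Section ergodicity.
Context {R : realType}.
Implicit Types (s t x : R) (i : 'I_5) (A B C : set R).
Local Notation T := (@T5 R).
Local Notation X0 := (iterable (@T5_dom R) T).
Local Notation leb := (@lebesgue_measure R).
Local Notation mu := (@inv_density_measure R).

(** Points that reach an inner cut after n steps. Each stage is finite, so only countably many
    points of J have an undefined iterate. *)
Fixpoint backward_orbit n : set R :=
  if n is n'.+1 then \bigcup_(i : 'I_5) (branch_inv i @` backward_orbit n')
  else inner_cuts.

Lemma finite_backward_orbit n : finite_set (backward_orbit n).
Proof.
elim: n => [|n IH]; first exact: finite_inner_cuts.
by apply: bigcup_finite => // i _; exact: finite_image.
Qed.

Lemma not_iterable_backward_orbit t : J t -> ~ X0 t ->
  exists n, backward_orbit n t.
Proof.
move=> Jt /existsNP[n]; elim: n t Jt => [|n IH] t Jt tn.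
  by exists 0%N; apply: contrapT => /(J_T5_dom Jt).
have [/T5_domP[i /branch_inv_surj[s Js E]]|tN] := pselect (T5_dom t); last first.
  by exists 0%N; apply: contrapT => /(J_T5_dom Jt).
move: tn; rewrite iterSr E T5_branch_inv// => /(IH _ Js)[m ms].
by exists m.+1, i => //; exists s.
Qed.

Lemma countable_not_iterable : countable (J `\` X0).
Proof.
apply: (sub_countable (B := \bigcup_n backward_orbit n)).
  by apply: subset_card_le => t [Jt /(not_iterable_backward_orbit Jt)[n tn]]; exists n.
by apply: bigcup_countable => // n _; exact/finite_set_countable/finite_backward_orbit.
Qed.

Lemma lebesgue_not_iterable : leb (J `\` X0) = 0%E.
Proof. exact: countable_lebesgue_measure0 countable_not_iterable. Qed.

Lemma measurable_J : measurable (@J R : set (measurableTypeR R)).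
Proof. exact: measurable_itv. Qed.

Lemma iterable_sub_J : X0 `<=` J.
Proof. by move=> t; exact: iterable_J. Qed.

Lemma measurable_iterable : measurable (X0 : set (measurableTypeR R)).
Proof.
have -> : X0 = J `\` (J `\` X0) by rewrite setDD (setIidr iterable_sub_J).
apply: measurableD; first exact: measurable_J.
by apply: countable_measurable countable_not_iterable => t; exact: measurable_set1.
Qed.

Lemma measurable_inv A : A `<=` J -> measurable_fun A (fun t : R => (t^-1)%:E).
Proof.
move=> AJ; apply: (measurable_funS measurable_J AJ).
apply/measurable_EFinP; apply: open_continuous_measurable_fun.
  exact: interval_open.
move=> t; rewrite inE => /J_itv[t0 _].
by apply: inv_continuous; rewrite gt_eqF.
Qed.

Lemma inv_density_null A : measurable A -> leb A = 0%E -> mu A = 0%E.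
Proof.
move=> mA A0; rewrite /mu; apply: null_set_integral.
- by apply: measurableI => //; exact: measurable_J.
- exact: measurable_inv.
- by apply/eqP; rewrite eq_le -{1}A0 lebesgue_le//= lebesgue_ge0.
Qed.

(** On J this branch shrinks distances by a factor of at most 9, as (s + 3) (t + 3) / 3 <= 9. *)
Lemma lebesgue_branch_inv1 A : A `<=` J -> leb A != 0%E -> leb (branch_inv 1 @` A) != 0%E.
Proof.
move=> AJ; apply: contra_neq => A0; apply/eqP; rewrite eq_le lebesgue_ge0 andbT.
have -> : (0 = (2 * 9)%:E * leb (branch_inv 1 @` A))%E by rewrite A0 mule0.
apply: (lebesgue_expanding (f := branch_inv 1)) => // s t As At.
have [/AJ/J_itv[s0 sw] /AJ/J_itv[t0 tw]] := (As, At); clear A0.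
have /andP[w1 w2] := @sqrt3_bounds R.
have -> : branch_inv 1 s - branch_inv 1 t = 3 * (t - s) / ((s + 3) * (t + 3)).
  by rewrite /=; field; nonzero.
have q0 : 0 < (s + 3) * (t + 3) by rewrite mulr_gt0; lra.
rewrite normrM normrM normfV (gtr0_norm q0) (distrC t) mulrA ler_pdivlMr//.
by rewrite mulrC mulrA ler_wpM2r// (ger0_norm (ler0n _ _)); nra.
Qed.

Lemma visits_iterable B A : measurable B -> B `<=` X0 -> leb B != 0%E ->
  A `<=` X0 -> leb A != 0%E -> exists x n, B x /\ A (iter n.+1 T x).
Proof.
move=> mB BX B0 AX A0.
have AJ : A `<=` J by move=> t /AX /iterable_J.
have SA s : (branch_inv 1 @` A) s -> J s /\ cut1 < s.
  move=> [t /AJ Jt <-]; split; first exact: (@branch_inv_J R (@Ordinal 5 1 isT)).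
  by have /andP[] := @branch_inv_itv R (@Ordinal 5 1 isT) _ Jt.
have [x [n [Bx [s As E]]]] := visits mB BX B0 SA (lebesgue_branch_inv1 AJ A0).
exists x, n; split=> //; rewrite iterS -E.
by rewrite (@T5_branch_inv R (@Ordinal 5 1 isT))//; exact: AJ.
Qed.

Lemma ergodic_T5 : ergodic mu (@T5_dom R) T.
Proof.
move=> A mA AX invA; apply: contrapT => /not_orP[A0 B0].
have {}A0 : leb A != 0%E by apply: contra_notN A0 => /eqP; exact: inv_density_null.
have mB : measurable (X0 `\` A) by apply: measurableD => //; exact: measurable_iterable.
have {}B0 : leb (X0 `\` A) != 0%E by apply: contra_notN B0 => /eqP; exact: inv_density_null.
have [x [n [[Xx Ax]]]] := visits_iterable mB (@subDsetl _ _ _) B0 AX A0.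
(* Invariance of A carries membership backwards along the orbit, down to x itself. *)
elim: n => [|n IH] An; first by apply: Ax; rewrite -invA.
apply: IH; rewrite -invA; split=> //; exact: iterable_iter.
Qed.

Lemma conservative_T5 : conservative mu (@T5_dom R) T.
Proof.
move=> [W [mW WX W0 /trivIsetP triv]].
have {}W0 : leb W != 0%E.
  by apply/eqP => /(inv_density_null mW) ; exact: (elimF eqP (gt_eqF W0)).
have [x [n [Wx Wn]]] := visits_iterable mW WX W0 WX W0.
(* x lies in W and returns to it at a positive time, hence in two preimages of W that should be
   disjoint. *)
have E := triv 0%N n.+1 Logic.I Logic.I isT.
suff : set0 x by []; rewrite -E; by split; split=> //; exact: WX.
Qed.

(** * Invariance of the density 1/t *)

Lemma inv_densityE A : mu A = (\int[leb]_(t in J `&` A) (t^-1)%:E)%E.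
Proof. by []. Qed.

Lemma inv_density_itv (a b : R) : 0 < a -> a < b -> b <= sqrt3 ->
  mu `]a, b[ = (ln b - ln a)%:E.
Proof.
move=> a0 ab bw; rewrite inv_densityE (setIidr _); last first.
  move=> t; rewrite /= in_itv /= => /andP[ta tb]; apply/J_itv.
  by rewrite (lt_trans a0) ?(lt_le_trans tb).
have abJ : `]a, b[ `<=` @J R.
  move=> t; rewrite /= in_itv /= => /andP[ta tb]; apply/J_itv.
  by rewrite (lt_trans a0) ?(lt_le_trans tb).
rewrite -(@integral_itv_bndoo _ _ _ _ true false); last exact: measurable_inv.
rewrite (@continuous_FTC2 _ (@GRing.inv R) (@ln R))//.
- apply: continuous_in_subspaceT => t /set_mem /=; rewrite in_itv /= => /andP[ta _].
  by apply: inv_continuous; rewrite gt_eqF// (lt_le_trans a0).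
- have dln t : 0 < t -> derivable (@ln R) t 1.
    by move=> t0; have [] := is_derive1_ln t0.
  split.
  + by move=> t; rewrite in_itv /= => /andP[ta _]; apply: dln; exact: lt_trans ta.
  + by apply: cvg_at_right_filter; exact: continuous_ln.
  + by apply: cvg_at_left_filter; apply: continuous_ln; exact: lt_trans ab.
- move=> t; rewrite in_itv /= => /andP[ta _]; rewrite derive1E.
  by have [_ ->] := is_derive1_ln (lt_trans a0 ta).
Qed.

(** The part of the i-th interval that T sends above a; odd branches reverse the order. *)
Definition branch_ray (a : R) (i : nat) : set R :=
  if odd i then `]branch_cut i, branch_inv i a[%classic
  else `]branch_inv i a, branch_cut i.+1[%classic.

Lemma branch_inv_mono i s t : 0 <= s -> 0 <= t ->
  (if odd i then branch_inv i t < branch_inv i s else branch_inv i s < branch_inv i t)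
  = (s < t).
Proof.
move=> s0 t0; have q (a : R) : 0 <= a -> [/\ 0 < 1 + a, 0 < a + 3, 0 < 2 * a + 3 & 0 < a + 2].
  by move=> ?; split; lra.
have [s1 s3 s23 s2] := q _ s0; have [t1 t3 t23 t2] := q _ t0.
elim/I5_ind: i => /=; rewrite ltr_pdivrMr// mulrAC ltr_pdivlMr//.
- by apply/idP/idP; lra.
- by apply/idP/idP; lra.
- by apply/idP/idP; lra.
- by apply/idP/idP; lra.
- by apply/idP/idP; lra.
Qed.

(** The default value 0 lies outside every ray ]a, oo[ with a >= 0, so the preimages of these rays
    come from the five branches alone. *)
Lemma T5_off_dom t : ~ T5_dom t -> T t = 0.
Proof.
move=> tN; have N i : (t \in `]branch_cut i, branch_cut i.+1[) = false.
  by apply/negP; rewrite in_itv => ti; apply: tN; apply/T5_domP; exists i.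
rewrite /T5 (N (@Ordinal 5 0 isT)) (N (@Ordinal 5 1 isT)) (N (@Ordinal 5 2 isT)).
by rewrite (N (@Ordinal 5 3 isT)) (N (@Ordinal 5 4 isT)).
Qed.

Lemma T5_ge0 t : 0 <= T t.
Proof.
have [/T5_J/J_itv[/ltW]//|/T5_off_dom ->//] := pselect (T5_dom t).
Qed.

Lemma branch_inv0 i : branch_inv i 0 = branch_cut (if odd i then i.+1 else i) :> R.
Proof. by elim/I5_ind: i => /=; field. Qed.

Lemma branch_inv_bounds i (a : R) : 0 <= a < sqrt3 ->
  branch_cut i <= branch_inv i a <= branch_cut i.+1.
Proof.
rewrite le_eqVlt => /andP[/predU1P[<- _|a0 aw]].
  rewrite branch_inv0; have := branch_cut_lt (R:=R) i.
  by case: ifP => _ /ltW ->; rewrite lexx.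
by have /andP[/ltW -> /ltW ->] := branch_inv_itv i ((J_itv a).2 (conj a0 aw)).
Qed.

Lemma branch_ray_itv i (a t : R) : 0 <= a < sqrt3 -> branch_ray a i t ->
  branch_cut i < t < branch_cut i.+1.
Proof.
move=> /(branch_inv_bounds i)/andP[lo hi]; rewrite /branch_ray.
case: ifP => _ /=; rewrite in_itv /= => /andP[ta tb]; apply/andP; split => //.
  exact: lt_le_trans hi.
exact: le_lt_trans ta.
Qed.

Lemma T5_ray (a : R) : 0 <= a < sqrt3 ->
  T @^-1` `]a, +oo[ = \bigcup_(i : 'I_5) branch_ray a i.
Proof.
move=> /[dup] aJ /andP[a0 aw]; apply/seteqP; split=> t.
  rewrite /= in_itv /= andbT => aT.
  have [/T5_domP[i /[dup] lohi /branch_inv_surj[s Js E]]|tN] := pselect (T5_dom t);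
    last by rewrite T5_off_dom// ltNge a0 in aT.
  exists i => //; move: aT lohi; have /J_itv[s0 sw] := Js.
  rewrite E T5_branch_inv// -(branch_inv_mono i a0 (ltW s0)) /branch_ray.
  by case: ifP => _ Sa /andP[lo hi]; rewrite /= in_itv /= ?lo ?hi Sa.
move=> [i _ ti]; have [s Js E] := branch_inv_surj (branch_ray_itv aJ ti).
have /J_itv[/ltW s0 _] := Js.
rewrite /= in_itv /= andbT E T5_branch_inv// -(branch_inv_mono i)//.
by move: ti; rewrite /branch_ray E; case: ifP => _ /=; rewrite in_itv /= => /andP[].
Qed.

Lemma trivIset_branch_ray (a : R) : 0 <= a < sqrt3 ->
  trivIset setT (fun i : 'I_5 => branch_ray a i).
Proof.
move=> aJ; apply/trivIsetP => i j _ _ ij; apply/seteqP; split=> // t [].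
move=> /(branch_ray_itv aJ)/branch_inv_surj[s Js Es].
move=> /(branch_ray_itv aJ)/branch_inv_surj[u Ju Eu].
have [E _] := branch_inv_inj Js Ju (etrans (esym Es) Eu).
by rewrite E eqxx in ij.
Qed.

Lemma measurable_branch_ray (a : R) (i : nat) :
  measurable (branch_ray a i : set (measurableTypeR R)).
Proof. by rewrite /branch_ray; case: ifP => _; exact: measurable_itv. Qed.

Lemma inv_density_branch_ray i (a : R) : 0 < a < sqrt3 ->
  mu (branch_ray a i) = (if odd i then ln (branch_inv i a) - ln (branch_cut i)
     else ln (branch_cut i.+1) - ln (branch_inv i a))%:E.
Proof.
move=> /andP[a0 aw]; have /andP[lo hi] := branch_inv_itv i ((J_itv a).2 (conj a0 aw)).
have cw : branch_cut i.+1 <= sqrt3 :> R by apply: (@branch_cut_mono R i.+1 5); rewrite ltn_ord.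
have c0 : 0 <= branch_cut i :> R by exact: (@branch_cut_mono R 0 i (ltnW (ltn_ord i))).
have i0 : odd i -> 0 < branch_cut i :> R.
  move=> oi; apply: (lt_le_trans (@branch_cut_lt R (@Ordinal 5 0 isT))).
  by apply: (@branch_cut_mono R 1 i); rewrite odd_gt0// ltnW.
rewrite /branch_ray; case: ifP => [/i0 c1|_]; apply: inv_density_itv => //.
  by rewrite (le_trans (ltW hi)).
exact: le_lt_trans lo.
Qed.

(** With S_i the value of [branch_inv i] at a, the logarithms of the inner cuts cancel in pairs, and
    S_1 S_3 / (S_0 S_2 S_4) = 1 / a. *)
Lemma inv_density_T5_ray (a : R) : 0 < a < sqrt3 ->
  mu (T @^-1` `]a, +oo[) = (ln sqrt3 - ln a)%:E.
Proof.
move=> /[dup] aJ' /andP[a0 aw]; have aJ : 0 <= a < sqrt3 by rewrite ltW.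
have -> : T @^-1` `]a, +oo[ = \big[setU/set0]_(i < 5) branch_ray a i.
  rewrite T5_ray// -bigcup_mkord; apply/seteqP; split=> t [i i5 ti].
    by exists i; rewrite //= ltn_ord.
  by exists (Ordinal i5).
rewrite measure_semi_additive_ord//=; last 3 first.
- by move=> i; exact: measurable_branch_ray.
- exact: trivIset_branch_ray.
- by apply: bigsetU_measurable => i _; exact: measurable_branch_ray.
rewrite (eq_bigr _ (fun i _ => inv_density_branch_ray i aJ')).
rewrite !big_ord_recr big_ord0 /= add0e -!EFinD; congr EFin.
rewrite (_ : 3 + 3 * a = 3 * (1 + a)); last by ring.
by rewrite !(ln_div, lnM) ?posrE ?ln1; lra.
Qed.

Lemma inv_density_ray (a : R) : 0 < a < sqrt3 ->
  mu `]a, +oo[ = (ln sqrt3 - ln a)%:E.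
Proof.
move=> /andP[a0 aw]; rewrite -inv_density_itv// !inv_densityE; congr integral.
apply/seteqP; split=> t [/[dup] Jt /J_itv[t0 tw]]; rewrite /= !in_itv /= andbT.
  by move=> ->; rewrite tw.
by move=> /andP[-> _].
Qed.

Lemma inv_density_disjoint A : J `&` A = set0 -> mu A = 0%E.
Proof. by rewrite inv_densityE => ->; rewrite integral_set0. Qed.

Lemma measurable_T5 : measurable_fun setT (T : measurableTypeR R -> measurableTypeR R).
Proof.
apply: (measurability _ (RGenOInfty.measurableE R)) => _ [_ [a ->] <-]; rewrite setTI.
have [a0|a0] := ltP a 0.
  rewrite (_ : _ @^-1` _ = setT)//; apply/seteqP; split=> // t _.
  by rewrite /= in_itv /= andbT (lt_le_trans a0)// T5_ge0.
have [aw|wa] := ltP a sqrt3.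
  rewrite T5_ray ?a0//; apply: fin_bigcup_measurable => // i _; exact: measurable_branch_ray.
rewrite (_ : _ @^-1` _ = set0)//; apply/seteqP; split=> // t.
rewrite /= in_itv /= andbT; have [/T5_J/J_itv[_ tw]|/T5_off_dom ->] := pselect (T5_dom t).
  by move=> /(lt_trans)/(_ tw)/(le_lt_trans wa); rewrite ltxx.
by rewrite ltNge a0.
Qed.

Lemma sigma_finite_inv_density : sigma_finite J mu.
Proof.
exists (fun n => `]n.+1%:R^-1, sqrt3[%classic).
  apply/seteqP; split=> t.
    move=> /J_itv[t0 tw]; exists (Num.bound t^-1) => //=; rewrite in_itv /= tw andbT.
    rewrite invf_plt ?posrE//; apply: (lt_trans (archi_boundP _)).
      by rewrite invr_ge0 ltW.
    by rewrite ltr_nat.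
  move=> [n _]; rewrite /= in_itv /= => /andP[nt tw]; apply/J_itv; split=> //.
  by rewrite (lt_trans _ nt)// invr_gt0.
move=> n; split; first exact: measurable_itv.
have n1 : n.+1%:R^-1 < sqrt3 :> R.
  have /andP[w1 w2] := @sqrt3_bounds R.
  apply: (@le_lt_trans _ _ 1); last by lra.
  by rewrite invf_le1// ler1n.
by rewrite inv_density_itv ?ltry// invr_gt0.
Qed.

Lemma T5_lt_sqrt3 t : T t < sqrt3.
Proof.
by have [/T5_J/J_itv[]//|/T5_off_dom ->] := pselect (T5_dom t); rewrite sqrt3_gt0.
Qed.

Lemma inv_density_ray_T5 (a : R) : 0 < a ->
  mu (T @^-1` `]a, +oo[) = mu `]a, +oo[ /\ (mu `]a, +oo[ < +oo)%E.
Proof.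
move=> a0; have [aw|wa] := ltP a sqrt3.
  by rewrite inv_density_T5_ray ?inv_density_ray ?a0 ?ltry.
rewrite (_ : T @^-1` _ = set0); last first.
  by apply/seteqP; split=> // t; rewrite /= in_itv /= andbT ltNge (le_trans _ wa)// ltW// T5_lt_sqrt3.
rewrite measure0 inv_density_disjoint ?ltry//.
apply/seteqP; split=> // t [/J_itv[_ tw]]; rewrite /= in_itv /= andbT.
by move=> at'; have := lt_trans at' tw; rewrite ltNge wa.
Qed.

Lemma setI_ray (a b : R) : `]a, +oo[ `&` `]b, +oo[ = `]Num.max a b, +oo[%classic.
Proof.
by apply/seteqP; split=> t; rewrite /= !in_itv /= !andbT gt_max => /andP.
Qed.

(** Two measures that agree on the rays, a pi-system, coincide if the rays have finite measure. As
    mu is infinite near 0, both are first restricted to ]a, oo[. *)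
Lemma inv_density_T5_above A (a : R) : measurable (A : set (measurableTypeR R)) -> 0 < a ->
  mu (T @^-1` (A `&` `]a, +oo[)) = mu (A `&` `]a, +oo[).
Proof.
move=> mA a0.
have mray : measurable (`]a, +oo[%classic : set (measurableTypeR R)) by exact: measurable_itv.
pose m1 := mrestr (measure_function_pushforward__canonical__measure_function_Measure mu measurable_T5) mray.
pose m2 := mrestr mu mray.
have m12 B : RGenOInfty.G B -> m1 B = m2 B /\ (m1 B < +oo)%E.
  move=> [x ->]; rewrite /m1 /m2 /mrestr /= /pushforward setI_ray.
  have [|-> //] := @inv_density_ray_T5 (Num.max x a).
  by rewrite lt_max a0 orbT.
rewrite -[LHS]/(m1 A) -[RHS]/(m2 A).
apply: (@measure_unique _ R (measurableTypeR R) (@RGenOInfty.G R) (fun n => `](- n%:R), +oo[%classic)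
  (RGenOInfty.measurableE R) _ _ _ m1 m2) => //.
- by move=> _ _ [x ->] [y ->]; exists (Num.max x y); rewrite setI_ray.
- by move=> n; exists (- n%:R).
- apply/seteqP; split=> // t _; exists (Num.bound (- t)) => //=.
  rewrite in_itv /= andbT ltrNl.
  by have [t0|t0] := leP 0 (- t); [exact: archi_boundP|rewrite (lt_le_trans t0)].
- by move=> B /m12[].
- by move=> n; apply: (m12 _ _).2; exists (- n%:R).
Qed.

(** Continuity from below along the sets A [&] ]1/(n+1), oo[ removes the cutoff. *)
Lemma inv_density_T5 A : measurable (A : set (measurableTypeR R)) -> A `<=` `]0, +oo[ ->
  mu (T @^-1` A) = mu A.
Proof.
move=> mA A0; pose K n := A `&` `]n.+1%:R^-1, +oo[%classic.
have mK n : measurable (K n : set (measurableTypeR R)).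
  by apply: measurableI => //; exact: measurable_itv.
have AK : A = \bigcup_n K n.
  apply/seteqP; split=> [t At|t [n _ []]//].
  have := A0 _ At; rewrite /= in_itv /= andbT => t0.
  exists (Num.bound t^-1) => //; split => //=; rewrite in_itv /= andbT.
  rewrite invf_plt ?posrE//; apply: (lt_trans (archi_boundP _)).
    by rewrite invr_ge0 ltW.
  by rewrite ltr_nat.
have ndK : nondecreasing_seq K.
  move=> m n mn; apply/subsetPset => t [At]; rewrite /= !in_itv /= !andbT => mt.
  split=> //=; rewrite in_itv /= andbT; apply: le_lt_trans mt.
  by rewrite lef_pV2 ?posrE// ler_nat.
have mT B : measurable (B : set (measurableTypeR R)) -> measurable (T @^-1` B : set (measurableTypeR R)).
  by move=> mB; rewrite -[X in measurable X]setTI; exact: measurable_T5.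
have cK : mu (K n) @[n --> \oo] --> mu A.
  by rewrite [in X in _ --> X]AK; apply: nondecreasing_cvg_mu => //; rewrite -AK.
have cT : mu (T @^-1` K n) @[n --> \oo] --> mu (T @^-1` A).
  rewrite [in X in _ --> X]AK preimage_bigcup.
  apply: (@nondecreasing_cvg_mu _ _ _ mu (fun n => T @^-1` K n)).
  - by move=> n; exact: mT.
  - by rewrite -preimage_bigcup -AK; exact: mT.
  - by move=> m n mn; apply/subsetPset; apply: preimage_subset; apply/subsetPset; exact: ndK.
have E : (fun n => mu (T @^-1` K n)) = (fun n => mu (K n)).
  by apply/funext => n; rewrite inv_density_T5_above// invr_gt0.
by rewrite E in cT; exact: cvg_unique cT cK.
Qed.

Lemma invariant_T5 : invariant_measure mu (@T5_dom R) T.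
Proof.
move=> A mA AX; transitivity (mu (T @^-1` A)); last first.
  apply: inv_density_T5 => // t /AX /iterable_J /J_itv[t0 _].
  by rewrite /= in_itv /= andbT.
congr mu; apply/seteqP; split=> [t []//|t At]; split=> //.
(* Points sent into A are iterable: off the domain T takes the value 0, which is not in J, and the
   later iterates are those of a point of A. *)
have tdom : T5_dom t.
  apply: contrapT => /T5_off_dom Tt0; move: At; rewrite /= Tt0.
  by move=> /AX /iterable_J /J_itv[]; rewrite ltxx.
by case=> [//|n]; rewrite iterSr; exact: AX At n.
Qed.

End ergodicity.

Theorem theorem1p6 (R : realType) :
  matrix_generating_system Nmx base_triples Qform cone /\
  (@well_defined_system R 5 Nmx /\
   conjugate_off_finite (@FA R) (\bigcup_i branch_arc Nmx i) (hatT Nmx)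
     (@J R) (@T5_dom R) (@T5 R) (@conj_map R)) /\
  (lebesgue_measure (J `\` iterable (@T5_dom R) (@T5 R)) = 0%E /\
   [/\ sigma_finite J (@inv_density_measure R),
       invariant_measure (@inv_density_measure R) (@T5_dom R) (@T5 R),
       ergodic (@inv_density_measure R) (@T5_dom R) (@T5 R) &
       conservative (@inv_density_measure R) (@T5_dom R) (@T5 R)]).
Proof.
split; first exact: (generating_system R).
split; first by split; [exact: well_defined_system_N|exact: conjugate_T5].
split; first exact: lebesgue_not_iterable.
split.
- exact: sigma_finite_inv_density.
- exact: invariant_T5.
- exact: ergodic_T5.
- exact: conservative_T5.
Qed.
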